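(* For $n\ge 0$ let $\mathcal{I}_n$ be the semiorder arrangement in $\mathbb{R}^n$, consisting of the hyperplanes $x_i-x_j=-1$ and $x_i-x_j=1$ for $1\le i<j\le n$. Define formal power series $A_r(x)$, $r\ge 0$, by $$\frac{1-y+ye^x}{1-y+y^2-y^2e^x}=\sum_{r\ge 0}A_r(x)y^r.$$ Then $$\sum_{n\ge 0}\chi_{\mathcal{I}_n}(q)\frac{x^n}{n!}=\left(\lim_{r\to\infty}\frac{A_r(x)}{A_{r-1}(x)}\right)^q.$$ In particular, if $i_n$ is the number of semiorders on $[n]$, then $$\sum_{n\ge 0}(-1)^ni_n\frac{x^n}{n!}=\lim_{r\to\infty}\frac{A_{r-1}(x)}{A_r(x)}.$$ The limits are in the sense of convergence of formal power series.
   Context: For a hyperplane arrangement $\mathcal{A}$ (finite set of affine hyperplanes) in $\mathbb{R}^n$, the intersection poset $L_{\mathcal{A}}$ is the set of non-empty intersections of subsets of $\mathcal{A}$ (including the empty intersection $\hat 0=\mathbb{R}^n$), ordered by reverse inclusion; $r(x)=n-\dim x$ for $x\in L_{\mathcal{A}}$. The characteristic polynomial is $\chi_{\mathcal{A}}(q)=\sum_{x\in L_{\mathcal{A}}}\mu(\hat 0,x)\,q^{n-r(x)}$, where $\mu$ is the Möbius function of $L_{\mathcal{A}}$ (so it is $1$ for $n=0$). A semiorder on $[n]=\{1,\ldots,n\}$ is a partial order $P$ on $[n]$ for which there exist $n$ (closed) unit intervals $I_1,\ldots,I_n$ of $\mathbb{R}$ such that $i<j$ in $P$ if and only if $I_i$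 is disjoint from $I_j$ and to the left of it (with $i_0=1$). For a formal power series $F$ in $x$ with constant term $1$, $F^q=\exp(q\log F)$, with $q$ an indeterminate. Convergence: $\lim_{r\to\infty}F_r(x)=F(x)$ means that for every $b$ the coefficient of $x^b$ in $F_r(x)$ equals that in $F(x)$ for all sufficiently large $r$. *)

(* Defs.v *)
From HB Require Import structures.
From mathcomp Require Import all_boot all_order all_algebra finmap.
From mathcomp Require Import boolp classical_sets set_interval reals.

Set Implicit Arguments.
Unset Strict Implicit.
Unset Printing Implicit Defensive.

Import Order.TTheory GRing.Theory Num.Theory.

Local Open Scope ring_scope.

Record fps (R : Type) := Fps { coefs : nat -> R }.

Notation "{ 'fps' R }" := (fps R) (format "{ 'fps'  R }") : type_scope.

Section FpsRing.
Variable R : comNzRingType.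
Implicit Types f g h : {fps R}.

Lemma fpsP f g : coefs f =1 coefs g -> f = g.
Proof. by case: f g => [a] [b] /= /funext ->. Qed.

HB.instance Definition _ := gen_eqMixin {fps R}.
HB.instance Definition _ := gen_choiceMixin {fps R}.

Definition fpsC (c : R) := Fps (fun n => if n is 0%N then c else 0).
Definition fpsX := Fps (fun n => (n == 1)%N%:R : R).

Definition fps_opp f := Fps (fun n => - coefs f n).
Definition fps_add f g := Fps (fun n => coefs f n + coefs g n).
Definition fps_mul f g :=
  Fps (fun n => \sum_(i < n.+1) coefs f i * coefs g (n - i)%N).

Let fps_addA : associative fps_add.
Proof. by move=> f g h; apply: fpsP => n /=; rewrite addrA. Qed.
Let fps_addC : commutative fps_add.
Proof. by move=> f g; apply: fpsP => n /=; rewrite addrC. Qed.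
Let fps_add0 : left_id (fpsC 0) fps_add.
Proof. by move=> f; apply: fpsP => -[|n] /=; rewrite add0r. Qed.
Let fps_addN : left_inverse (fpsC 0) fps_opp fps_add.
Proof. by move=> f; apply: fpsP => -[|n] /=; rewrite addNr. Qed.

HB.instance Definition _ :=
  GRing.isZmodule.Build {fps R} fps_addA fps_addC fps_add0 fps_addN.

Let trunc n f := \poly_(i < n.+1) coefs f i.

Let coef_trunc n f k : (k <= n)%N -> (trunc n f)`_k = coefs f k.
Proof. by move=> le_kn; rewrite coef_poly ltnS le_kn. Qed.

Let trunc_mul n f g k :
  (k <= n)%N -> coefs (fps_mul f g) k = (trunc n f * trunc n g)`_k.
Proof.
move=> le_kn; rewrite coefM; apply: eq_bigr => i _.
by rewrite !coef_trunc ?(leq_trans (leq_subr _ _)) // (leq_trans (leq_ord i)).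
Qed.

Let fps_mulC : commutative fps_mul.
Proof.
by move=> f g; apply: fpsP => n; rewrite !(trunc_mul _ _ (leqnn n)) mulrC.
Qed.

Let fps_mulA : associative fps_mul.
Proof.
move=> f g h; apply: fpsP => n.
transitivity ((trunc n f * (trunc n g * trunc n h))`_n).
  rewrite coefM; apply: eq_bigr => i _.
  by rewrite coef_trunc ?leq_ord // (@trunc_mul n) ?leq_subr.
rewrite mulrA coefM; apply: eq_bigr => i _.
by rewrite coef_trunc ?leq_subr // (@trunc_mul n) ?leq_ord.
Qed.

Let fps_mul1 : left_id (fpsC 1) fps_mul.
Proof.
move=> f; apply: fpsP => n /=.
by rewrite big_ord_recl /= subn0 mul1r big1 ?addr0 // => i _; rewrite mul0r.
Qed.

Let fps_mulDl : left_distributive fps_mul fps_add.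
Proof.
move=> f g h; apply: fpsP => n /=; rewrite -big_split /=.
by apply: eq_bigr => i _; rewrite mulrDl.
Qed.

Let fps_1neq0 : fpsC 1 != 0 :> {fps R}.
Proof. by apply/eqP => -[] /(congr1 (@^~ 0%N)) /eqP; rewrite oner_eq0. Qed.

HB.instance Definition _ := GRing.Zmodule_isComNzRing.Build {fps R}
  fps_mulA fps_mulC fps_mul1 fps_mulDl fps_1neq0.

Lemma coefs0 n : coefs (0 : {fps R}) n = 0. Proof. by case: n. Qed.
Lemma coefs1 n : coefs (1 : {fps R}) n = (n == 0)%N%:R. Proof. by case: n. Qed.
Lemma coefsN f n : coefs (- f) n = - coefs f n. Proof. by []. Qed.
Lemma coefsD f g n : coefs (f + g) n = coefs f n + coefs g n. Proof. by []. Qed.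
Lemma coefsB f g n : coefs (f - g) n = coefs f n - coefs g n. Proof. by []. Qed.
Lemma coefsM f g n :
  coefs (f * g) n = \sum_(i < n.+1) coefs f i * coefs g (n - i)%N.
Proof. by []. Qed.

Lemma coefs0M f g : coefs (f * g) 0 = coefs f 0 * coefs g 0.
Proof. by rewrite coefsM big_ord1. Qed.

Lemma coefsCM c f n : coefs (fpsC c * f) n = c * coefs f n.
Proof.
rewrite coefsM big_ord_recl /= subn0 big1 ?addr0 // => i _.
by rewrite mul0r.
Qed.

Lemma coefs_exp_lt f k n : coefs f 0 = 0 -> (n < k)%N -> coefs (f ^+ k) n = 0.
Proof.
move=> f0; elim: k n => // k IHk n; rewrite ltnS => le_nk.
rewrite exprS coefsM big_ord_recl f0 mul0r add0r big1 // => i _.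
rewrite IHk ?mulr0 //; apply: leq_trans le_nk.
by case: n i => [[]//|n i]; rewrite lift0 subSS ltnS leq_subr.
Qed.

(* The composite \sum_k c k * f ^+ k; only meaningful when f has constant
   term 0, so that f ^+ k does not contribute to the coefficients n < k. *)
Definition fps_comp (c : nat -> R) f : {fps R} :=
  Fps (fun n => \sum_(k < n.+1) c k * coefs (f ^+ k) n).

Lemma fps_geometric f :
  coefs f 0 = 0 -> (1 - f) * fps_comp (fun=> 1) f = 1.
Proof.
move=> f0; apply: fpsP => n.
have compE i : (i <= n)%N ->
    coefs (fps_comp (fun=> 1) f) i = coefs (\sum_(k < n.+1) f ^+ k) i.
  move=> le_in /=; under eq_bigr do rewrite mul1r.
  have -> : coefs (\sum_(k < n.+1) f ^+ k) i
          = \sum_(k < n.+1) coefs (f ^+ k) i.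
    by apply: (big_morph (fun u : {fps R} => coefs u i)) => //; rewrite coefs0.
  rewrite (big_ord_widen_cond n.+1 xpredT (fun k => coefs (f ^+ k) i)) //=.
  rewrite big_mkcond /=; apply: eq_bigr => k _.
  by case: ltnP => // lt_ik; rewrite coefs_exp_lt.
transitivity (coefs ((1 - f) * \sum_(k < n.+1) f ^+ k) n).
  by rewrite !coefsM; apply: eq_bigr => i _; rewrite compE ?leq_subr.
rewrite -[1 - f]opprB mulNr -subrX1 opprB coefsB coefs_exp_lt ?subr0 //.
Qed.

End FpsRing.

Arguments fpsX {R}.

Section FpsUnitRing.
Variable R : comUnitRingType.
Implicit Types f g : {fps R}.

Definition fps_unit : pred {fps R} := fun f => coefs f 0 \is a GRing.unit.

Definition fps_inv f : {fps R} :=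
  if fps_unit f then
    fpsC (coefs f 0)^-1 * fps_comp (fun=> 1) (1 - fpsC (coefs f 0)^-1 * f)
  else f.

Let fps_mulV : {in fps_unit, left_inverse 1 fps_inv *%R}.
Proof.
move=> f; rewrite -topredE /= => fU; rewrite /fps_inv fU.
set u := fpsC _; rewrite mulrAC -{1}[u * f](subKr 1) fps_geometric //.
by rewrite coefsB coefs1 coefsCM mulVr ?subrr.
Qed.

Let fps_unitPl f g : g * f = 1 -> fps_unit f.
Proof.
move=> /(congr1 (fun u : {fps R} => coefs u 0)); rewrite coefs0M coefs1 => fg1.
by apply/unitrPr; exists (coefs g 0); rewrite mulrC.
Qed.

Let fps_inv_out : {in [predC fps_unit], fps_inv =1 id}.
Proof. by move=> f; rewrite inE -topredE /= /fps_inv => /negPf ->. Qed.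

HB.instance Definition _ := GRing.ComNzRing_hasMulInverse.Build {fps R}
  fps_mulV fps_unitPl fps_inv_out.

(* Factorials are meant to be units of R, e.g. R = rat or R = {poly rat}. *)
Definition fps_exp f : {fps R} := fps_comp (fun k => k`!%:R^-1) f.

Definition fps_log f : {fps R} :=
  fps_comp (fun k => if k is m.+1 then (-1) ^+ m / m.+1%:R else 0) (f - 1).

Definition egf (a : nat -> R) : {fps R} := Fps (fun n => a n / n`!%:R).

Definition fps_cvg (u : nat -> {fps R}) f :=
  forall b, exists N, forall r, (N <= r)%N -> coefs (u r) b = coefs f b.

End FpsUnitRing.

(* f ^ q = exp (q log f) as a power series over rat[q]; the indeterminate q is
   the variable 'X of {poly rat}. *)
Definition fps_powq (f : {fps rat}) : {fps {poly rat}} :=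
  fps_exp (Fps (fun n => coefs (fps_log f) n *: 'X)).

(* [moebius_rec] descends along chains of P, so #|` P| is enough fuel. *)
Section Moebius.
Variables (T : choiceType) (P : {fset T}) (le : rel T).

Fixpoint moebius_rec (m : nat) (x y : T) : int :=
  if x == y then 1 else
  if m is m'.+1 then
    - \sum_(z <- P | [&& le x z, le z y & z != y]) moebius_rec m' x z
  else 0.

Definition moebius : T -> T -> int := moebius_rec #|` P|.

End Moebius.

Local Open Scope classical_set_scope.

Section Arrangements.
Variables (R : realType) (n : nat).
Local Notation V := 'rV[R]_n.

Definition is_hyperplane (H : set V) :=
  exists (a : V) (c : R), a != 0 /\ H = [set x | \sum_i a 0 i * x 0 i = c].

Record arrangement := Arrangement {
  hyperplanes :> {fset set V};
  _ : forall H, H \in hyperplanes -> is_hyperplane H }.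

Implicit Types (A : arrangement) (X Y : set V).

Definition intersection (B : {fset set V}) : set V := \bigcap_(H in [set` B]) H.

Definition intersection_poset A : {fset set V} :=
  [fset X in [fset intersection B | B in fpowerset A] | X != set0]%fset.

Definition flat_le : rel (set V) := fun X Y => `[< Y `<=` X >].

Definition affine_dim X : nat :=
  xget 0%N [set d | exists (p : V) (U : {vspace V}),
                      X = [set x | x - p \in U] /\ d = \dim U].

Definition flat_rank X : nat := (n - affine_dim X)%N.

Definition charpoly A : {poly int} :=
  \sum_(X <- intersection_poset A)
    moebius (intersection_poset A) flat_le setT X *: 'X^(n - flat_rank X).

Definition diff_hyperplane (c : R) (ij : 'I_n * 'I_n) : set V :=
  [set x | x 0 ij.1 - x 0 ij.2 = c].

Definition semiorder_hyperplanes : {fset set V} :=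
  ([fset diff_hyperplane (-1) ij | ij in [pred ij : 'I_n * 'I_n | ij.1 < ij.2]%N]
   `|` [fset diff_hyperplane 1 ij | ij in [pred ij : 'I_n * 'I_n | ij.1 < ij.2]%N])%fset.

Lemma diff_hyperplaneP c (ij : 'I_n * 'I_n) :
  (ij.1 < ij.2)%N -> is_hyperplane (diff_hyperplane c ij).
Proof.
case: ij => i j /= lt_ij; have neq_ij : i != j by rewrite neq_ltn lt_ij.
exists (delta_mx 0 i - delta_mx 0 j), c; split.
  apply/eqP => /matrixP /(_ 0 i); rewrite !mxE !eqxx (negPf neq_ij) subr0.
  by move/eqP; rewrite oner_eq0.
rewrite /diff_hyperplane; apply/funext => x /=; congr (_ = c).
under eq_bigr do rewrite !mxE !eqxx mulrBl.
rewrite sumrB (bigD1 i) //= eqxx mul1r big1 ?addr0; last first.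
  by move=> k /negPf ->; rewrite mul0r.
rewrite (bigD1 j) //= eqxx mul1r big1 ?addr0 //.
by move=> k /negPf ->; rewrite mul0r.
Qed.

Lemma semiorder_hyperplanesP H : H \in semiorder_hyperplanes -> is_hyperplane H.
Proof.
rewrite inE => /orP[] /imfsetP[ij /= lt_ij ->]; exact: diff_hyperplaneP.
Qed.

Definition semiorder_arrangement : arrangement :=
  Arrangement semiorder_hyperplanesP.

(* A partial order on [n] is the set of the pairs (i, j) with i <= j. *)
Definition is_porder (P : {set 'I_n * 'I_n}) :=
  [/\ forall i, (i, i) \in P,
      forall i j, (i, j) \in P -> (j, i) \in P -> i = j
    & forall i j k, (i, j) \in P -> (j, k) \in P -> (i, k) \in P].

Definition left_disjoint (I J : set R) :=
  I `&` J = set0 /\ forall s t, I s -> J t -> s < t.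

Definition is_semiorder (P : {set 'I_n * 'I_n}) :=
  is_porder P /\
  exists I : 'I_n -> set R,
    (forall i, exists a, I i = `[a, a + 1]) /\
    (forall i j, (i, j) \in P /\ i != j <-> left_disjoint (I i) (I j)).

Definition nb_semiorders : nat := #|[set P | `[< is_semiorder P >]]%SET|.

End Arrangements.

(* Main.v *)
(* The characteristic polynomial is evaluated by the finite field method.
   Whitney's expansion writes chi(q) as a signed sum of q^dim over the subsets
   of the hyperplanes x_j - x_i = 1 with non-empty intersection.  For n < q the
   system x_j - x_i = 1, (i, j) in B, is solvable over Z/q exactly when it is
   over R, and then has q^dim solutions; so chi(q) counts the maps [n] -> Z/q
   whose image contains no two cyclically adjacent residues.  Sorting these maps
   by their image, the exponential generating function in n is the independence
   polynomial of the q-cycle at E = e^x - 1, namely L^q + (1 - L)^q where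
   L^2 = L + E and L has constant term 1; the second summand only has terms of
   degree >= q.  So chi_n(q) / n! and the coefficient of x^n in L^q are
   polynomials in q which agree for all large q.  The A_r satisfy
   A_(r+2) = A_(r+1) + E A_r, whence their ratios tend to L.  Finally semiorders
   correspond to the regions of the arrangement, which number (-1)^n chi(-1) by
   Zaslavsky's theorem, and L^q at q = -1 is 1 / L. *)
From HB Require Import structures.
Require Import Defs.
From mathcomp Require Import all_boot all_order all_algebra finmap.
From mathcomp Require Import boolp classical_sets set_interval reals.
From mathcomp Require Import ring lra zify.

Set Implicit Arguments.
Unset Strict Implicit.
Unset Printing Implicit Defensive.

Import Order.TTheory GRing.Theory Num.Theory.

Local Open Scope ring_scope.

(** * Formal power series *)

Section FpsTheory.
Variable R : comNzRingType.
Implicit Types f g h : {fps R}.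

Lemma coefs_sum (I : Type) (r : seq I) (P : pred I) (F : I -> {fps R}) n :
  coefs (\sum_(i <- r | P i) F i) n = \sum_(i <- r | P i) coefs (F i) n.
Proof. by apply: (big_morph (fun u : {fps R} => coefs u n)) => //; rewrite coefs0. Qed.

Lemma coefsXM f n : coefs (fpsX * f) n = if n is m.+1 then coefs f m else 0.
Proof.
rewrite coefsM; case: n => [|n]; first by rewrite big_ord1 mul0r.
rewrite big_ord_recl mul0r add0r big_ord_recl /= mul1r subSS subn0.
by rewrite big1 ?addr0 // => i _; rewrite mul0r.
Qed.

Lemma coefs_expX k n : coefs (fpsX ^+ k : {fps R}) n = (n == k)%:R.
Proof.
elim: k n => [|k IHk] n; first by rewrite coefs1.
by rewrite exprS coefsXM; case: n => [|n] //; rewrite IHk.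
Qed.

Lemma coefs0_exp f k : coefs (f ^+ k) 0 = coefs f 0 ^+ k.
Proof.
elim: k => [|k IHk]; first by rewrite !expr0 coefs1.
by rewrite !exprS coefs0M IHk.
Qed.

Lemma coefsMr_lt f g k n :
  (forall b, (b < k)%N -> coefs g b = 0) -> (n < k)%N -> coefs (f * g) n = 0.
Proof.
move=> g0 lt_nk; rewrite coefsM big1 // => i _.
by rewrite g0 ?mulr0 // (leq_ltn_trans (leq_subr _ _)).
Qed.

Lemma coefsMl_lt f g k n : coefs f 0 = 0 ->
  (forall b, (b < k)%N -> coefs g b = 0) -> (n < k.+1)%N -> coefs (f * g) n = 0.
Proof.
move=> f0 g0 lt_nk; rewrite coefsM big_ord_recl f0 mul0r add0r big1 // => i _.
rewrite g0 ?mulr0 // lift0; case: n i lt_nk => [[]//|n i] lt_nk.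
by rewrite subSS (leq_ltn_trans (leq_subr _ _)).
Qed.

Definition deriv_fps f : {fps R} := Fps (fun n => coefs f n.+1 *+ n.+1).

Lemma coefs_deriv f n : coefs (deriv_fps f) n = coefs f n.+1 *+ n.+1.
Proof. by []. Qed.

Lemma deriv_fpsM f g :
  deriv_fps (f * g) = deriv_fps f * g + f * deriv_fps g.
Proof.
apply: fpsP => n; rewrite [LHS]/= coefsD.
pose F i := coefs f i * coefs g (n.+1 - i)%N.
have -> : coefs (f * g) n.+1 *+ n.+1 =
    \sum_(i < n.+2) F i *+ i + \sum_(i < n.+2) F i *+ (n.+1 - i).
  rewrite coefsM -big_split -sumrMnl /=; apply: eq_bigr => i _.
  by rewrite -mulrnDr subnKC // -ltnS.
congr (_ + _).
  rewrite big_ord_recl mulr0n add0r coefsM; apply: eq_bigr => i _.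
  by rewrite /F lift0 subSS /= mulrnAl.
rewrite coefsM big_ord_recr /= subnn mulr0n addr0; apply: eq_bigr => i _.
by rewrite /F subSn 1?mulrnAr //= -ltnS.
Qed.

Lemma deriv_fps_exp f k :
  deriv_fps (f ^+ k.+1) = f ^+ k * deriv_fps f *+ k.+1.
Proof.
elim: k => [|k IHk]; first by rewrite expr1 expr0 mul1r.
rewrite exprS deriv_fpsM IHk [RHS]mulrS mulrC; congr (_ + _).
by rewrite mulrnAr mulrA -exprS.
Qed.

(** Powers [f ^+ k] vanish below degree [k], so a single bound [n] serves all coefficients of degree
    at most [n]: there the composite is a polynomial in [f]. *)
Lemma fps_comp_trunc (c : nat -> R) f n i : coefs f 0 = 0 -> (i <= n)%N ->
  coefs (fps_comp c f) i = \sum_(k < n.+1) c k * coefs (f ^+ k) i.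
Proof.
move=> f0 le_in; rewrite /=.
rewrite (big_ord_widen_cond n.+1 xpredT (fun k => c k * coefs (f ^+ k) i)) //=.
rewrite big_mkcond /=; apply: eq_bigr => k _.
by case: ltnP => // lt_ik; rewrite coefs_exp_lt ?mulr0.
Qed.

(** Coefficient [n] only sees terms of degree at most [n], where the derived series may be replaced
    by its truncation [F]; the chain rule then reduces to the rule for powers. *)
Lemma deriv_fps_comp (c : nat -> R) f : coefs f 0 = 0 ->
  deriv_fps (fps_comp c f)
    = fps_comp (fun k => c k.+1 *+ k.+1) f * deriv_fps f.
Proof.
move=> f0; apply: fpsP => n; rewrite coefsM.
pose F := \sum_(k < n.+1) fpsC (c k.+1 *+ k.+1) * f ^+ k : {fps R}.
transitivity (coefs (F * deriv_fps f) n).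
  rewrite mulr_suml coefs_sum coefs_deriv [coefs (fps_comp _ _) _]/=.
  rewrite big_ord_recl expr0 coefs1 mulr0 add0r -sumrMnl.
  apply: eq_bigr => k _; rewrite lift0 -mulrA coefsCM mulrnAl -mulrnAr.
  rewrite -mulrnAr -coefs_deriv deriv_fps_exp.
  have coefsMn g j : coefs (g *+ j) n = coefs g n *+ j.
    by elim: j => [|j IHj]; rewrite ?mulr0n ?coefs0 // !mulrS coefsD IHj.
  by rewrite coefsMn mulrnAr.
rewrite coefsM; apply: eq_bigr => i _; congr (_ * _).
rewrite (@fps_comp_trunc _ _ n) ?leq_ord // coefs_sum.
by apply: eq_bigr => k _; rewrite coefsCM.
Qed.

End FpsTheory.

(** * Logarithmic derivatives and the powers f^q *)

Section FpsLogDeriv.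
Implicit Types f g h : {fps rat}.

Lemma fps_unitE (R : comUnitRingType) (f : {fps R}) :
  (f \is a GRing.unit) = (coefs f 0 \is a GRing.unit).
Proof. by []. Qed.

(** The equation u' = h u yields coefficient n+1 of u from the lower ones, as n+1 is invertible.
    This is how values of f^q are identified without expanding exponentials or logarithms. *)
Lemma deriv_fps_inj h f g : deriv_fps f = h * f -> deriv_fps g = h * g ->
  coefs f 0 = coefs g 0 -> f = g.
Proof.
move=> df dg fg0; apply: fpsP => n; elim/ltn_ind: n => -[//|n] IHn.
have: coefs (deriv_fps f) n = coefs (deriv_fps g) n.
  rewrite df dg !coefsM; apply: eq_bigr => i _.
  by rewrite IHn // ltnS leq_subr.
by move/eqP => /=; rewrite eqrMn2r // => /eqP.
Qed.

(** Differentiation cancels the denominators of the logarithm and leaves the signs (-1)^k, that is,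
    the geometric series of [1 - f], whose sum is the inverse of [f]. *)
Lemma deriv_fps_log f : coefs f 0 = 1 ->
  deriv_fps (fps_log f) = deriv_fps f / f.
Proof.
move=> f0; rewrite /fps_log deriv_fps_comp; last by rewrite coefsB coefs1 f0 subrr.
have -> : deriv_fps (f - 1) = deriv_fps f.
  by apply: fpsP => n; rewrite !coefs_deriv coefsB coefs1 subr0.
have fU : f \is a GRing.unit by rewrite fps_unitE f0 unitr1.
rewrite mulrC; congr (_ * _); apply: (mulrI fU); rewrite divrr //.
have f10 : coefs (1 - f) 0 = 0 by rewrite coefsB coefs1 f0 subrr.
rewrite -[X in X * _](subKr 1) -[RHS](fps_geometric f10); congr (_ * _).
apply: fpsP => n /=; apply: eq_bigr => k _; rewrite -(opprB 1 f) [(- (1 - f)) ^+ k]exprNn.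
have -> : (-1) ^+ k = fpsC ((-1) ^+ k) :> {fps rat}.
  elim: (nat_of_ord k) => [|j IHj]; first by apply: fpsP => -[].
  rewrite !exprS IHj; apply: fpsP => -[|i]; rewrite mulN1r coefsN /=.
    by rewrite mulN1r.
  by rewrite oppr0.
rewrite coefsCM mul1r -[_ *+ k.+1]mulr_natr divfK ?pnatr_eq0 // mulrA.
by rewrite -exprD addnn -signr_odd odd_double mul1r.
Qed.

Lemma poly_natr_unit k : k.+1%:R \is a @GRing.unit {poly rat}.
Proof.
by rewrite -polyC_natr poly_unitE coefC eqxx size_polyC pnatr_eq0 /= unitfE pnatr_eq0.
Qed.

Lemma deriv_fps_powq f : coefs f 0 = 1 ->
  deriv_fps (fps_powq f)
    = Fps (fun n => coefs (deriv_fps f / f) n *: 'X) * fps_powq f.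
Proof.
move=> f0; rewrite /fps_powq /fps_exp deriv_fps_comp; last first.
  by rewrite /= big_ord1 mul0r scale0r.
rewrite mulrC; congr (_ * _).
  by apply: fpsP => n; rewrite -deriv_fps_log // !coefs_deriv scalerMnl.
(* The exponential series is its own derivative, (k+1) / (k+1)! = 1 / k!; over [{poly rat}] this
   division needs the factorials to be units. *)
congr fps_comp; apply/funext => k.
have kU : k.+1%:R \is a @GRing.unit {poly rat} := poly_natr_unit k.
have fU : k`!%:R \is a @GRing.unit {poly rat}.
  by rewrite -(prednK (fact_gt0 k)) poly_natr_unit.
by rewrite factS natrM invrM // -[LHS]mulr_natr -mulrA mulVr // mulr1.
Qed.

Definition fps_eval (G : {fps {poly rat}}) (a : rat) : {fps rat} :=
  Fps (fun n => (coefs G n).[a]).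

Lemma deriv_fps_eval_powq f a : coefs f 0 = 1 ->
  deriv_fps (fps_eval (fps_powq f) a)
    = (fpsC a * (deriv_fps f / f)) * fps_eval (fps_powq f) a.
Proof.
move=> f0; apply: fpsP => n.
have := congr1 (fun G => (coefs G n).[a]) (deriv_fps_powq f0).
rewrite coefs_deriv hornerMn => eq_n.
rewrite [coefs (fps_eval _ _) _.+1]/= eq_n !coefsM horner_sum.
apply: eq_bigr => i _; rewrite hornerM coefsCM; congr (_ * _).
by rewrite hornerZ hornerX mulrC.
Qed.

Lemma coefs0_eval_powq f a : coefs (fps_eval (fps_powq f) a) 0 = 1.
Proof. by rewrite /= big_ord1 fact0 invr1 mul1r expr0 coefs1 hornerC. Qed.

(** Both sides solve u' = k (f'/f) u with constant term 1, so [deriv_fps_inj] identifies them. *)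
Lemma fps_eval_powq_nat f k : coefs f 0 = 1 ->
  fps_eval (fps_powq f) k%:R = f ^+ k.
Proof.
move=> f0; have fU : f \is a GRing.unit by rewrite fps_unitE f0 unitr1.
apply: (deriv_fps_inj (deriv_fps_eval_powq _ f0)); last first.
  by rewrite coefs0_eval_powq coefs0_exp f0 expr1n.
have -> : fpsC k%:R = k%:R :> {fps rat}.
  elim: k => [|k IHk]; first by apply: fpsP => n; rewrite coefs0; case: n.
  rewrite -[in RHS]natr1 -IHk; apply: fpsP => n; rewrite coefsD coefs1 /=.
  by case: n => [|n] /=; rewrite ?natr1 ?addr0.
case: k => [|k].
  by apply: fpsP => n; rewrite !mul0r coefs0 coefs_deriv expr0 coefs1 mul0rn.
rewrite deriv_fps_exp mulr_natl !mulrnAl exprSr mulrCA; congr (_ *+ _).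
by rewrite divrK.
Qed.

Lemma fps_eval_powqN1 f : coefs f 0 = 1 -> fps_eval (fps_powq f) (-1) = f^-1.
Proof.
move=> f0; have fU : f \is a GRing.unit by rewrite fps_unitE f0 unitr1.
apply: (deriv_fps_inj (deriv_fps_eval_powq _ f0)); last first.
  rewrite coefs0_eval_powq; have /(congr1 (fun g => coefs g 0)) := divrr fU.
  by rewrite coefs0M f0 mul1r coefs1.
have -> : fpsC (-1) = -1 :> {fps rat}.
  by apply: fpsP => n; rewrite coefsN coefs1; case: n => //=; rewrite oppr0.
(* The derivative of the inverse comes from differentiating f f^-1 = 1. *)
apply: (mulrI fU); apply: (addrI (deriv_fps f * f^-1)).
rewrite -deriv_fpsM divrr // mulN1r mulNr mulrN mulrCA [f * _]mulrC.
rewrite mulVr // mulr1 subrr.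
by apply: fpsP => n; rewrite coefs0 coefs_deriv coefs1 mul0rn.
Qed.

End FpsLogDeriv.

(** * Convergence of the ratios of consecutive A_r *)

Section ContinuedFraction.
Variables (E : {fps rat}) (A : nat -> {fps rat}).
Hypotheses (E0 : coefs E 0 = 0) (A0 : A 0%N = 1) (A1 : A 1%N = 1 + E).
Hypothesis A_rec : forall r, A r.+2 = A r.+1 + E * A r.

Lemma coefs0_A r : coefs (A r) 0 = 1.
Proof.
elim/ltn_ind: r => -[|[|r]] IHr.
- by rewrite A0 coefs1.
- by rewrite A1 coefsD coefs1 E0 addr0.
- by rewrite A_rec coefsD coefs0M E0 mul0r addr0 IHr.
Qed.

Lemma A_unit r : A r \is a GRing.unit.
Proof. by rewrite fps_unitE coefs0_A unitr1. Qed.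

Let Q r : {fps rat} := A r.+1 / A r.

Let Q_unit r : Q r \is a GRing.unit.
Proof. by rewrite unitrM unitrV !A_unit. Qed.

(** The linear recurrence becomes the continued fraction step Q_(r+1) = 1 + E / Q_r, whose fixed
    points are the roots of L^2 = L + E. *)
Let Q_rec r : Q r.+1 * Q r = Q r + E.
Proof.
rewrite /Q mulrA divrK ?A_unit // A_rec mulrDl; congr (_ + _).
by rewrite mulrK // A_unit.
Qed.

(** The step is a contraction for the x-adic topology: a difference of consecutive ratios is [E]
    times a multiple of the previous difference, and [E] has no constant term, so one more
    coefficient becomes stable. *)
Let Q_cauchy r b : (b < r)%N -> coefs (Q r.+1 - Q r) b = 0.
Proof.
elim: r b => // r IHr b lt_br.
have -> : Q r.+2 - Q r.+1 = E * ((Q r - Q r.+1) / (Q r.+1 * Q r)).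
  apply: (mulIr (Q_unit r.+1)); apply: (mulIr (Q_unit r)).
  rewrite -[RHS]mulrA -[RHS]mulrA divrK; last by rewrite unitrM !Q_unit.
  rewrite mulrBl Q_rec mulrBl -[Q r.+1 * Q r.+1 * _]mulrA Q_rec; ring.
apply: (coefsMl_lt E0 _ lt_br) => c lt_cr.
rewrite [_ / _]mulrC; apply: (@coefsMr_lt _ _ _ r c _ lt_cr) => d lt_dr.
by rewrite -opprB coefsN IHr ?oppr0.
Qed.

(** Coefficient [b] is read off the ratio [Q b.+1], from which index on [Q_cauchy] keeps it
    fixed. *)
Definition ratio_limit : {fps rat} := Fps (fun b => coefs (A b.+2 / A b.+1) b).

Let Q_limit r b : (b < r)%N -> coefs (Q r) b = coefs ratio_limit b.
Proof.
elim: r => // r IHr; rewrite ltnS leq_eqVlt => /orP[/eqP -> //|lt_br].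
by have /eqP := Q_cauchy lt_br; rewrite coefsB subr_eq0 => /eqP ->; apply: IHr.
Qed.

Lemma ratio_limit_coefs0 : coefs ratio_limit 0 = 1.
Proof.
rewrite -(@Q_limit 1) // coefs0M coefs0_A mul1r.
have /(congr1 (fun g => coefs g 0)) := divrr (A_unit 1).
by rewrite coefs0M coefs0_A mul1r coefs1.
Qed.

(** This is [Q_rec] in the limit: up to degree [n], both [Q n.+1] and [Q n.+2] already agree with
    the limit. *)
Lemma ratio_limit_sqr : ratio_limit ^+ 2 = ratio_limit + E.
Proof.
apply: fpsP => n; rewrite coefsD -(Q_limit (ltnSn n)) -coefsD -Q_rec expr2 !coefsM.
apply: eq_bigr => i _.
by rewrite !Q_limit // ltnS ?leq_subr // (leq_trans (leq_ord i)).
Qed.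

(** The ratio of index r is Q_(r-1), which explains the bound b+2; it also skips r = 0, where the
    predecessor is truncated to 0. *)
Lemma ratio_cvg : fps_cvg (fun r => A r / A r.-1) ratio_limit.
Proof. by move=> b; exists b.+2 => -[//|r] lt_br; apply: Q_limit. Qed.

Lemma ratio_cvgV : fps_cvg (fun r => A r.-1 / A r) ratio_limit^-1.
Proof.
have LU : ratio_limit \is a GRing.unit.
  by rewrite fps_unitE ratio_limit_coefs0 unitr1.
move=> b; exists b.+2 => -[//|r] lt_br; apply/eqP; rewrite -subr_eq0 -coefsB.
(* A difference of inverses 1/Q - 1/L is a multiple of L - Q, which vanishes below degree [r]. *)
have -> : A r / A r.+1 - ratio_limit^-1
    = (A r / A r.+1 / ratio_limit) * (ratio_limit - Q r).
  rewrite mulrBr divrK // -mulrA [_^-1 * _]mulrC; congr (_ - _).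
  have -> : A r * (ratio_limit^-1 / A r.+1) * Q r
      = ratio_limit^-1 * ((A r.+1 / A r.+1) * (A r / A r)) by rewrite /Q; ring.
  by rewrite !divrr ?A_unit // !mulr1.
apply/eqP; apply: (@coefsMr_lt _ _ _ r) lt_br => c lt_cr.
by rewrite coefsB Q_limit // subrr.
Qed.

End ContinuedFraction.

(** * Independence polynomials and surjections *)

Section SubsetSums.
Local Open Scope set_scope.
Variable T : finType.
Implicit Types (S D : {set T}) (k : T).

(** Splitting by membership of [k] is the common induction step for binomial sums, independence
    polynomials and Zaslavsky's theorem. *)
Lemma sum_subsetU1 (V : nmodType) k D (F : {set T} -> V) : k \notin D ->
  \sum_(S : {set T} | S \subset k |: D) F S
    = \sum_(S : {set T} | S \subset D) F S
      + \sum_(S : {set T} | S \subset D) F (k |: S).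
Proof.
move=> kD; rewrite (bigID (fun S : {set T} => k \in S)) /= addrC; congr (_ + _).
  apply: eq_bigl => S; apply/andP/idP => [[SkD kS]|SD].
    apply/fintype.subsetP => i iS; have := fintype.subsetP SkD i iS.
    by rewrite !inE => /orP[/eqP ik|//]; rewrite -ik iS in kS.
  split; first exact: fintype.subset_trans SD (finset.subsetU1 _ _).
  by apply: contra kD => /(fintype.subsetP SD).
rewrite (reindex_onto (fun S => k |: S) (fun S => S :\ k)) /=; last first.
  by move=> S /andP[_ kS]; rewrite finset.setD1K.
apply: eq_bigl => S; rewrite finset.setU11 andbT.
apply/andP/idP => [[SkD /eqP eqS]|SD].
  have kS : k \notin S by rewrite -eqS !inE eqxx.
  apply/fintype.subsetP => i iS; have := fintype.subsetP SkD i.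
  rewrite !inE iS orbT => /(_ isT) /orP[/eqP ik|//].
  by rewrite -ik iS in kS.
split; first exact: finset.setUS.
rewrite finset.setU1K //; apply: contra kD => /(fintype.subsetP SD).
by [].
Qed.

Lemma subset_ind (P : {set T} -> Prop) :
  P finset.set0 -> (forall k D, k \notin D -> P D -> P (k |: D)) -> forall D, P D.
Proof.
move=> P0 PU D; elim/ltn_ind: {D}#|D| {-2}D (erefl #|D|) => m IHm D cardD.
have [->//|[k kD]] := finset.set_0Vmem D.
rewrite -(finset.setD1K kD); apply: PU; first by rewrite !inE eqxx.
by apply: (IHm #|D :\ k|) => //; rewrite -cardD (cardsD1 k D) kD.
Qed.

Lemma sum_subset_exp (R : comPzRingType) (t : R) D :
  \sum_(S : {set T} | S \subset D) t ^+ #|S| = (1 + t) ^+ #|D|.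
Proof.
elim/subset_ind: D => [|k D kD IHD].
  rewrite cards0 expr0 (eq_bigl (pred1 finset.set0)) ?big_pred1_eq ?cards0 //.
  by move=> S; rewrite /= finset.subset0.
rewrite sum_subsetU1 // cardsU1 kD exprS mulrDl mul1r IHD; congr (_ + _).
rewrite -IHD mulr_sumr; apply: eq_bigr => S SD; rewrite cardsU1 -exprS.
by case: (boolP (k \in S)) => // /(fintype.subsetP SD); rewrite (negPf kD).
Qed.

Lemma sum_subset_sign (R : comPzRingType) D :
  \sum_(S : {set T} | S \subset D) (-1) ^+ #|S| = (D == finset.set0)%:R :> R.
Proof. by rewrite sum_subset_exp subrr expr0n cards_eq0. Qed.

End SubsetSums.

Section IndependencePolynomial.
Local Open Scope set_scope.
Variables (R : comPzRingType) (t : R) (T : finType) (e : rel T).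
Hypotheses (e_sym : symmetric e) (e_irr : irreflexive e).
Implicit Types (S D : {set T}).

Definition independent S := [forall u in S, forall v in S, ~~ e u v].

Lemma independentP S :
  reflect {in S &, forall u v, ~~ e u v} (independent S).
Proof.
apply: (iffP forall_inP) => [indS u v uS vS|indS u uS].
  by have /forall_inP := indS u uS; apply.
by apply/forall_inP => v vS; apply: indS.
Qed.

Definition indep_poly D : R :=
  \sum_(S : {set T} | S \subset D) (independent S)%:R * t ^+ #|S|.

Lemma indep_poly0 : indep_poly finset.set0 = 1.
Proof.
rewrite /indep_poly (eq_bigl (pred1 finset.set0)) => [|S]; last first.
  by rewrite /= finset.subset0.
rewrite big_pred1_eq cards0 expr0 mulr1; case: independentP => // -[].
by move=> u v; rewrite inE.
Qed.

(** Vertex deletion: an independent set either avoids [k], or consists of [k] and an independent set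
    of vertices not adjacent to [k]. *)
Lemma indep_polyU1 k D : k \notin D ->
  indep_poly (k |: D)
    = indep_poly D + t * indep_poly [set u in D | ~~ e k u]%SET.
Proof.
move=> kD; rewrite /indep_poly sum_subsetU1 //; congr (_ + _).
rewrite mulr_sumr (bigID (fun S => S \subset [set u in D | ~~ e k u]%SET)) /=.
(* A set containing a neighbour of [k] is no longer independent once [k] is added. *)
rewrite [X in _ + X]big1 ?addr0 => [|S /andP[SD nSe]]; last first.
  case: independentP => [indS|_]; last by rewrite mul0r.
  case/negP: nSe; apply/fintype.subsetP => u uS; rewrite inE (fintype.subsetP SD) //.
  by apply: indS; rewrite !inE ?eqxx ?uS ?orbT.
apply: eq_big => [S|S /andP[SD Se]].
  rewrite andb_idl // => /fintype.subsetP Se; apply/fintype.subsetP => u /Se.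
  by rewrite inE => /andP[].
have kS : k \notin S by apply: contra kD => /(fintype.subsetP SD).
rewrite cardsU1 kS exprS mulrCA; congr (_ * (_%:R * _)); congr nat_of_bool.
have ke u : u \in S -> ~~ e k u by move/(fintype.subsetP Se); rewrite inE => /andP[].
apply/independentP/independentP => indS u v.
  by move=> uS vS; apply: indS; rewrite !inE ?uS ?vS orbT.
rewrite !inE => /orP[/eqP->|uS] /orP[/eqP->|vS]; rewrite ?e_irr ?ke //.
  by rewrite e_sym ke.
exact: indS.
Qed.

End IndependencePolynomial.

(** * Independence polynomials of paths and cycles *)

Section CycleIndependence.
Local Open Scope set_scope.
Variables (R : comPzRingType) (t L : R).
Hypothesis L_root : L ^+ 2 = L + t.

(** The independence polynomial of a path with [m] vertices, through its Fibonacci-type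
    recurrence. *)
Fixpoint path_poly (m : nat) : R :=
  match m with
  | 0%N => 1
  | m'.+1 => if m' is m''.+1 then path_poly m' + t * path_poly m'' else 1 + t
  end.

Lemma path_polySS m : path_poly m.+2 = path_poly m.+1 + t * path_poly m.
Proof. by []. Qed.

Variable m : nat.
Local Notation q := m.+3.

Definition cycle_adj : rel 'Z_q := fun u v => (v - u == 1) || (u - v == 1).

Lemma cycle_adj_sym : symmetric cycle_adj.
Proof. by move=> u v; rewrite /cycle_adj orbC. Qed.

Lemma cycle_adj_irr : irreflexive cycle_adj.
Proof. by move=> u; rewrite /cycle_adj subrr. Qed.

Lemma val_Zp_eqS (u v : 'Z_q) : (v - u == 1) = ((v : nat) == (u.+1 %% q)%N).
Proof.
rewrite subr_eq addrC -val_eqE /= (@modn_small 1) //.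
by rewrite addn1.
Qed.

Lemma cycle_adjE (u v : 'Z_q) :
  cycle_adj u v = ((v : nat) == (u.+1 %% q)%N) || ((u : nat) == (v.+1 %% q)%N).
Proof. by rewrite /cycle_adj !val_Zp_eqS. Qed.

Definition arc_set (a k : nat) : {set 'Z_q} := [set u : 'Z_q | (a <= u < a + k)%N]%SET.

(** The first bound keeps the arc from wrapping past 0, the second keeps it from closing up to the
    whole cycle. Deleting the last vertex gives the recurrence of [path_poly]. *)
Lemma indep_poly_arc a k : (a + k <= q)%N -> (k < q)%N ->
  indep_poly t cycle_adj (arc_set a k) = path_poly k.
Proof.
elim/ltn_ind: k => -[|k] IHk le_akq lt_kq.
  have -> : arc_set a 0 = finset.set0.
    by apply/finset.setP => u; rewrite !inE; apply/negP; lia.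
  exact: indep_poly0.
have lt_ak : (a + k < q)%N by lia.
have -> : arc_set a k.+1 = (Ordinal lt_ak : 'Z_q) |: arc_set a k.
  apply/finset.setP => u; rewrite !inE -val_eqE /=; apply/idP/idP; lia.
rewrite indep_polyU1; first last.
- by rewrite !inE /=; lia.
- exact: cycle_adj_irr.
- exact: cycle_adj_sym.
rewrite IHk; [|lia|lia|lia].
case: k => [|k] in IHk le_akq lt_kq lt_ak *.
  have -> : [set u in arc_set a 0 | ~~ cycle_adj (Ordinal lt_ak : 'Z_q) u]%SET = finset.set0.
    by apply/finset.setP => u; rewrite !inE; apply/negP; lia.
  by rewrite indep_poly0 mulr1.
have -> : [set u in arc_set a k.+1 | ~~ cycle_adj (Ordinal lt_ak : 'Z_q) u]%SET = arc_set a k.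
  apply/finset.setP => u; have lt_uq : (u < q)%N := ltn_ord u.
  rewrite !inE cycle_adjE /=; case: (ltnP (a + k.+2) q) => [lt_|ge_].
    rewrite (@modn_small (a + k.+1).+1); last lia.
    case: (ltnP u.+1 q) => ltu; last by apply/idP/idP; lia.
    by rewrite (@modn_small u.+1) //; apply/idP/idP; lia.
  (* Here the last vertex of the arc is q-1, which is adjacent to 0; but the arc is not the whole
     cycle, so [a] is positive and 0 lies outside. *)
  have -> : ((a + k.+1).+1 = q)%N by lia.
  rewrite modnn.
  case: (ltnP u.+1 q) => ltu; last by apply/idP/idP; lia.
  by rewrite (@modn_small u.+1) //; apply/idP/idP; lia.
by rewrite IHk ?path_polySS //; lia.
Qed.

(** Deleting the vertex q-1 leaves a path with q-1 vertices; deleting also its neighbours 0 and q-2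
    leaves the arc from 1 to q-3. *)
Lemma indep_poly_cycle :
  indep_poly t cycle_adj [set: 'Z_q]%SET = path_poly m.+2 + t * path_poly m.
Proof.
have -> : [set: 'Z_q]%SET = (Ordinal (ltnSn m.+2) : 'Z_q) |: arc_set 0 m.+2.
  apply/finset.setP => u; have lt_uq : (u < q)%N := ltn_ord u.
  by rewrite !inE -val_eqE /=; apply/esym; lia.
rewrite indep_polyU1; first last.
- by rewrite !inE /=; lia.
- exact: cycle_adj_irr.
- exact: cycle_adj_sym.
rewrite indep_poly_arc //; congr (_ + t * _).
have [le1 le2] : (1 + m <= q)%N /\ (m < q)%N by lia.
rewrite -(indep_poly_arc le1 le2).
congr indep_poly; apply/finset.setP => u; have lt_uq : (u < q)%N := ltn_ord u.
rewrite !inE cycle_adjE /= modnn.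
case: (ltnP u.+1 q) => ltu; last by apply/idP/idP; lia.
by rewrite (@modn_small u.+1) //; apply/idP/idP; lia.
Qed.

(** Both sides satisfy c_(q+2) = c_(q+1) + t c_q, since [L] and [1 - L] are the two roots of X^2 = X
    + t; the cases q = 3 and q = 4 are computed. *)
Lemma cycle_poly_root : path_poly m.+2 + t * path_poly m = L ^+ q + (1 - L) ^+ q.
Proof.
have Lt : t = L ^+ 2 - L by rewrite L_root addrC addrA addNr add0r.
elim/ltn_ind: m => -[|[|k]] IHk; [by rewrite /= Lt; ring|by rewrite /= Lt; ring|].
have e1 := IHk k.+1 (ltnSn _); have e0 := IHk k (leqW (ltnSn _)).
have -> : path_poly k.+4 + t * path_poly k.+2 =
  (path_poly k.+3 + t * path_poly k.+1) + t * (path_poly k.+2 + t * path_poly k).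
  by rewrite !path_polySS Lt; ring.
by rewrite e1 e0 Lt !exprS; ring.
Qed.

End CycleIndependence.

(** * Counting maps by their image *)

Section Surjections.

Lemma fps_exp_coefs k n :
  coefs (fps_exp fpsX ^+ k : {fps rat}) n = k%:R ^+ n / n`!%:R.
Proof.
elim: k n => [|k IHk] n.
  by rewrite expr0 coefs1 expr0n; case: n => [|n]; rewrite ?mul0r ?divr1.
rewrite exprSr coefsM -[in RHS]natr1 exprDn mulr_suml.
have coefs_e i : coefs (fps_exp fpsX : {fps rat}) i = i`!%:R^-1.
  rewrite /= (bigD1 ord_max) //= coefs_expX eqxx mulr1 big1 ?addr0 // => j ne_j.
  rewrite coefs_expX; case: eqVneq => [eq_ij|_]; last by rewrite mulr0.
  by case/negP: ne_j; apply/eqP/val_inj.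
rewrite (reindex_inj rev_ord_inj); apply: eq_bigr => i _.
rewrite [nat_of_ord (rev_ord i)]/=.
have le_in : (i <= n)%N by rewrite -ltnS.
rewrite IHk coefs_e subSS subKn // expr1n mulr1 -mulr_natr.
have := bin_fact le_in => /(congr1 (fun x => x%:R : rat)).
rewrite !natrM => <-; have F j : j`!%:R != 0 :> rat by rewrite pnatr_eq0 -lt0n fact_gt0.
have B : 'C(n, i)%:R != 0 :> rat by rewrite pnatr_eq0 -lt0n bin_gt0.
by field; rewrite !F B.
Qed.

Variable K : finType.

Definition ffun_image n (f : {ffun 'I_n -> K}) : {set K} := [set f i | i in 'I_n]%SET.

Lemma card_ffun_image_subset n (S : {set K}) :
  #|[set f : {ffun 'I_n -> K} | ffun_image f \subset S]%SET| = (#|S| ^ n)%N.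
Proof.
rewrite -[n in RHS]card_ord -card_ffun_on; apply: eq_card => f; rewrite inE.
apply/fintype.subsetP/ffun_onP => [fS i|fS u /imsetP[i _ ->]]; last exact: fS.
by apply: fS; apply: imset_f.
Qed.

(** Summed over all subsets of [S], both sides give the coefficient of e^(|S| x): the left counts
    all maps into [S], the right is the binomial theorem for 1 + (e^x - 1). By induction the proper
    subsets cancel and the term of [S] remains. *)
Lemma card_ffun_image n (S : {set K}) :
  #|[set f : {ffun 'I_n -> K} | ffun_image f == S]%SET|%:R / n`!%:R
    = coefs ((fps_exp fpsX - 1) ^+ #|S| : {fps rat}) n.
Proof.
elim/ltn_ind: {S}#|S| {-2}S (erefl #|S|) => s IHs S cardS.
have := congr1 (fun m => m%:R / n`!%:R : rat) (card_ffun_image_subset n S).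
have <- : coefs (\sum_(S' : {set K} | S' \subset S) (fps_exp fpsX - 1) ^+ #|S'|) n
    = (#|S| ^ n)%:R / n`!%:R :> rat.
  by rewrite sum_subset_exp addrC subrK fps_exp_coefs natrX.
rewrite coefs_sum.
rewrite -sum1_card (partition_big (@ffun_image n) (fun S' => S' \subset S)) /=; last first.
  by move=> f; rewrite inE.
rewrite natr_sum mulr_suml (bigD1 S) // [in RHS](bigD1 S) //= => eqS.
have sum_S (S' : {set K}) : S' \subset S ->
    (\sum_(f | (f \in [set f : {ffun 'I_n -> K} | ffun_image f \subset S]%SET)
       && (ffun_image f == S')) 1)%N
    = #|[set f : {ffun 'I_n -> K} | ffun_image f == S']%SET|.
  move=> S'S; rewrite sum1_card; apply: eq_card => f; rewrite unfold_in !inE.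
  by case: eqP => [->|]; rewrite ?S'S ?andbF.
move: eqS; rewrite sum_S // cardS => eqS.
apply: (addIr _ (etrans eqS _)); congr (_ + _); apply: eq_bigr => S' /andP[S'S neS].
rewrite sum_S // (IHs #|S'|) // -cardS proper_card // finset.properEneq neS.
by [].
Qed.

Lemma card_ffun_indep n (e : rel K) :
  #|[set f : {ffun 'I_n -> K} | independent e (ffun_image f)]%SET|%:R / n`!%:R
    = coefs (indep_poly (fps_exp fpsX - 1) e [set: K]%SET : {fps rat}) n.
Proof.
rewrite -sum1_card (partition_big (@ffun_image n) (independent e)) /=; last first.
  by move=> f; rewrite inE.
rewrite natr_sum mulr_suml /indep_poly coefs_sum [in RHS](eq_bigl xpredT) => [|S]; last first.
  by rewrite finset.subsetT.
rewrite big_mkcond; apply: eq_bigr => S _; case: ifP => indS; last first.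
  by rewrite mul0r coefs0.
rewrite mul1r -card_ffun_image; congr (_%:R / _); rewrite -sum1_card.
by apply: eq_bigl => f; rewrite !inE; case: eqP => [->|]; rewrite ?indS ?andbF.
Qed.

End Surjections.

Lemma card_ffun_cycle n m (L : {fps rat}) :
  L ^+ 2 = L + (fps_exp fpsX - 1) -> coefs L 0 = 1 -> (n < m.+3)%N ->
  #|[set f : {ffun 'I_n -> 'Z_m.+3} | [forall i, forall j, f j - f i != 1]]%SET|%:R
    = n`!%:R * coefs (L ^+ m.+3) n.
Proof.
move=> L_root L0 lt_nm.
have n0 : n`!%:R != 0 :> rat by rewrite pnatr_eq0 -lt0n fact_gt0.
apply: (mulIf (invr_neq0 n0)); rewrite mulrAC divff // mul1r.
transitivity (coefs (indep_poly (fps_exp fpsX - 1) (@cycle_adj m) [set: _]%SET : {fps rat}) n).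
  rewrite -card_ffun_indep; congr (_%:R / _); apply: eq_card => f; rewrite !inE.
  (* As [i] and [j] range over all ordered pairs, avoiding the difference 1 also avoids -1, which is
     independence of the image in the cycle. *)
  apply/forallP/independentP => [fn u v /imsetP[i _ ->] /imsetP[j _ ->]|ind i].
    rewrite /cycle_adj negb_or; have /forallP -> := fn i.
    by have /forallP -> := fn j.
  apply/forallP => j; have := ind (f i) (f j).
  rewrite !imset_f // => /(_ isT isT); rewrite /cycle_adj negb_or.
  by case/andP.
rewrite indep_poly_cycle (cycle_poly_root L_root) coefsD.
(* [1 - L] has no constant term, so its q-th power vanishes in degree n < q. *)
by rewrite [X in _ + X]coefs_exp_lt ?addr0 // coefsB coefs1 L0 subrr.
Qed.

(** * Whitney's theorem and the finite field method *)

Section MoebiusUnique.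
Variables (T : choiceType) (P : {fset T}) (le : rel T).
Hypotheses (le_refl : reflexive le) (le_trans : transitive le).
Hypothesis le_anti : forall x y, le x y -> le y x -> x = y.

(** The number of elements of [P] below a point is the measure that bounds the fuel of
    [moebius_rec]. *)
Lemma count_le_lt z y : y \in P -> le z y -> z != y ->
  (count (le^~ z) P < count (le^~ y) P)%N.
Proof.
move=> yP zy ne_zy; rewrite -!size_filter.
have: uniq (y :: [seq x <- P | le x z]).
  rewrite /= filter_uniq ?fset_uniq // andbT mem_filter negb_and.
  by apply/orP; left; apply: contra ne_zy => /(le_anti zy) ->.
move=> /uniq_leq_size; apply => x; rewrite inE mem_filter => /orP[/eqP->|].
  by rewrite mem_filter le_refl.
by case/andP => xz xP; rewrite mem_filter xP (le_trans xz).
Qed.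

(** Isolating the term z = y in the vanishing sum gives the recursion of [moebius_rec], so the two
    agree by induction on the fuel. *)
Lemma moebius_unique (f : T -> int) x : (forall z, le x z) -> f x = 1 ->
  (forall y, y \in P -> y != x -> \sum_(z <- P | le z y) f z = 0) ->
  forall y, y \in P -> moebius P le x y = f y.
Proof.
move=> x_min fx f_sum y yP; rewrite /moebius.
have: (count (le^~ y) P <= #|` P|)%N by rewrite count_size.
elim: #|` P| y yP => [|m IHm] y yP.
  by rewrite leqn0 -leqn0 leqNgt -has_count => /hasP[]; exists y.
move=> le_ym /=; case: eqVneq => [<- //|ne_xy].
rewrite eq_sym in ne_xy.
have: \sum_(z <- [seq z <- P | le z y]) f z = 0 by rewrite big_filter f_sum.
rewrite (bigD1_seq y) ?filter_uniq ?fset_uniq ?mem_filter ?le_refl //=.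
move/eqP; rewrite addr_eq0 => /eqP ->; congr (- _).
rewrite big_filter_cond big_seq_cond [RHS]big_seq_cond.
apply: eq_big => [z|z /andP[zP /and3P[_ zy ne_zy]]]; first by rewrite x_min.
by apply: IHm => //; rewrite -ltnS (leq_trans _ le_ym) // count_le_lt.
Qed.

End MoebiusUnique.

(** * Functions and vectors that are constant on the blocks of a graph *)

Section Retract.
Variables (T : finType) (rho : T -> T).
Hypothesis rhoK : forall i, rho (rho i) = rho i.

Let fixed := {i : T | rho i == i}.

Let rho_fixed i : rho (rho i) == rho i. Proof. by rewrite rhoK. Qed.

Let retract i : fixed := exist _ (rho i) (rho_fixed i).

Let retractK (i : fixed) : retract (val i) = i.
Proof. by apply: val_inj => /=; apply/eqP/(valP i). Qed.

Let card_fixed : #|{: fixed}| = #|[set i | rho i == i]%SET|.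
Proof. by rewrite card_sig; apply: eq_card => i; rewrite !inE. Qed.

(** Such a function is freely determined by its values at the fixed points of [rho]. The exponent is
    the dimension found in [retract_vspace], which is what ties point counts modulo q to real
    dimensions. *)
Lemma card_ffun_retract (K : finType) :
  #|[set f : {ffun T -> K} | [forall i, f i == f (rho i)]]%SET|
    = (#|K| ^ #|[set i | rho i == i]%SET|)%N.
Proof.
rewrite -card_fixed -card_ffun.
pose ext (g : {ffun fixed -> K}) := [ffun i => g (retract i)].
have ext_inj : injective ext.
  move=> g h /ffunP eq_gh; apply/ffunP => i.
  by have := eq_gh (val i); rewrite !ffunE retractK.
rewrite -(card_imset _ ext_inj); apply: eq_card => f; rewrite inE.
apply/forallP/imsetP => [f_rho|[g _ ->] i]; last first.
  by rewrite !ffunE; apply/eqP; congr (g _); apply: val_inj; rewrite /= rhoK.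
exists [ffun i => f (val i)] => //; apply/ffunP => i.
by rewrite !ffunE /=; apply/eqP/f_rho.
Qed.

End Retract.

Section RetractSpace.
Variables (F : fieldType) (n : nat) (rho : 'I_n -> 'I_n).
Hypothesis rhoK : forall i, rho (rho i) = rho i.

Lemma retract_vspace : exists2 U : {vspace 'rV[F]_n},
  \dim U = #|[set i | rho i == i]%SET|
  & forall u, (u \in U) = [forall i, u 0 i == u 0 (rho i)].
Proof.
pose fixed := {i : 'I_n | rho i == i}.
have rho_fixed i : rho (rho i) == rho i by rewrite rhoK.
pose retract i : fixed := exist _ (rho i) (rho_fixed i).
pose ext (g : {ffun fixed -> F^o}) : 'rV[F]_n := \row_i g (retract i).
have ext_lin : linear ext.
  by move=> a g h; apply/rowP => i; rewrite !mxE !ffunE.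
pose extL := GRing.isLinear.Build _ _ _ _ ext ext_lin.
pose extH : {linear {ffun fixed -> F^o} -> 'rV[F]_n} := HB.pack ext extL.
exists (limg (linfun extH)).
  have ker0 : (fullv :&: lker (linfun extH) = 0)%VS.
    apply/eqP; rewrite capfv; apply/lker0P => g h; rewrite !lfunE /= => /rowP eq_gh.
    apply/ffunP => i; have := eq_gh (val i); rewrite !mxE.
    suff -> : retract (val i) = i by [].
    by apply: val_inj => /=; apply/eqP/(valP i).
  rewrite (limg_dim_eq ker0) dimvf /dim /= muln1 card_sig.
  by apply: eq_card => i; rewrite !inE.
move=> u; apply/memv_imgP/forallP => [[g _ ->] i|u_rho].
  by rewrite lfunE /= !mxE; apply/eqP; congr (g _); apply: val_inj; rewrite /= rhoK.
exists [ffun i : fixed => u 0 (val i) : F^o]; first exact: memvf.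
by apply/rowP => i; rewrite lfunE /= !mxE !ffunE /=; apply/eqP/u_rho.
Qed.

End RetractSpace.

Section Blocks.
Variables (n : nat) (B : {set 'I_n * 'I_n}).

Definition pair_rel : rel 'I_n := fun i j => ((i, j) \in B) || ((j, i) \in B).

Lemma pair_rel_sym : connect_sym pair_rel.
Proof. by apply: sym_connect_sym => i j; rewrite /pair_rel orbC. Qed.

(** The number of connected components of the graph with edge set [B], each counted through its
    root. *)
Definition nblocks := #|[set i | fingraph.root pair_rel i == i]%SET|.

Lemma nblocks_le : (nblocks <= n)%N.
Proof. by rewrite -[n in (_ <= n)%N]card_ord max_card. Qed.

Lemma constant_on_blocks (K : eqType) (f : 'I_n -> K) :
  (forall i j, (i, j) \in B -> f i = f j)
    <-> [forall i, f i == f (fingraph.root pair_rel i)].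
Proof.
split=> [f_const|/forallP f_root i j ijB]; last first.
  rewrite (eqP (f_root i)) (eqP (f_root j)); congr f.
  apply/(fingraph.rootP pair_rel_sym)/connect1.
  by rewrite /pair_rel ijB.
apply/forallP => i.
have cl : closed pair_rel [pred k | f i == f k].
  move=> j k; rewrite /pair_rel !inE => /orP[] /f_const eq_jk.
    by rewrite eq_jk.
  by rewrite eq_jk.
by have := closed_connect cl (connect_root pair_rel i); rewrite !inE eqxx => <-.
Qed.

End Blocks.

(** * Flats of the semiorder arrangement and Whitney's expansion *)

Section DiffFlats.
Local Open Scope classical_set_scope.
Variables (R : realType) (n : nat).
Local Notation V := 'rV[R]_n.
Implicit Types (B : {set 'I_n * 'I_n}) (X Y : set V).

(** Ordered pairs absorb the sign: for i < j, x_i - x_j = -1 is the pair (i, j) and x_i - x_j = 1 is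
    the pair (j, i). A diagonal pair demands 0 = 1 and makes the flat empty. *)
Definition diff_flat B : set V :=
  [set x | forall i j, (i, j) \in B -> x 0 j - x 0 i = 1].

Definition affine_space (p : V) (U : {vspace V}) : set V :=
  [set x | x - p \in U].

(** The choice made by [xget] is harmless: two presentations of one affine space have the same
    direction space. *)
Lemma affine_dimE p U : affine_dim (affine_space p U) = \dim U.
Proof.
rewrite /affine_dim; case: xgetP => [d _ [p' [U' [eqX ->]]]|]; last first.
  by move/(_ (\dim U)) => []; exists p, U.
have in_U x : (x - p \in U) = (x - p' \in U').
  have := congr1 (fun X : set V => X x) eqX => /= eqP.
  by apply/idP/idP; [rewrite [X in X -> _]eqP|rewrite [X in _ -> X]eqP].
have pp' : p - p' \in U' by rewrite -in_U subrr mem0v.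
congr (\dim _); apply/vspaceP => u.
have := in_U (p + u); rewrite [p + u - p]addrC addKr => ->.
by rewrite [p + u]addrC -addrA rpredDr.
Qed.

Lemma diff_flat_affine B p : diff_flat B p ->
  exists2 U : {vspace V}, \dim U = nblocks B & diff_flat B = affine_space p U.
Proof.
move=> pB; have rhoK := root_root (@pair_rel_sym n B).
have [U dimU inU] := retract_vspace R rhoK; exists U => //.
apply/seteqP; split=> x; rewrite /affine_space /= inU.
  move=> xB; apply/constant_on_blocks => i j ijB; rewrite !mxE.
  by have := xB i j ijB; have := pB i j ijB; lra.
move/constant_on_blocks => x_const i j ijB; have := x_const i j ijB.
by rewrite !mxE; have := pB i j ijB; lra.
Qed.

Lemma affine_dim_diff_flat B : diff_flat B !=set0 ->
  affine_dim (diff_flat B) = nblocks B.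
Proof.
by move=> [p /diff_flat_affine[U <- ->]]; rewrite affine_dimE.
Qed.

Lemma diff_flat0 : diff_flat finset.set0 = setT.
Proof. by apply/seteqP; split=> x //= _ i j; rewrite inE. Qed.

(** The sets [B] whose flat contains [X] are thus all the subsets of one fixed set, which makes
    alternating sums over them collapse. *)
Lemma sub_diff_flat B X :
  X `<=` diff_flat B <-> B \subset [set ij | `[< X `<=` diff_flat [set ij]%SET >]]%SET.
Proof.
split=> [XB|/fintype.subsetP BX x Xx i j /BX].
  apply/fintype.subsetP => -[i j] ijB; rewrite inE; apply/asboolP => x Xx k l.
  by rewrite inE => /eqP[-> ->]; apply: XB.
by rewrite inE => /asboolP /(_ x Xx i j); apply; rewrite inE.
Qed.

Local Notation P := (intersection_poset (semiorder_arrangement R n)).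

Lemma mem_semiorder_hyperplanes H :
  H \in semiorder_hyperplanes R n
    <-> exists ij : 'I_n * 'I_n, ij.1 != ij.2 /\ H = diff_flat [set ij]%SET.
Proof.
have flatE (i j : 'I_n) : diff_flat [set (i, j)]%SET = [set x | x 0 j - x 0 i = 1].
  apply/seteqP; split=> x /= => [|xij k l]; first by apply; rewrite inE.
  by rewrite inE => /eqP[-> ->].
rewrite inE; split=> [/orP[] /imfsetP[[i j]] /= lt_ij ->|[[i j] /= [ne_ij ->]]].
- have {}lt_ij : (i < j)%N := lt_ij.
  exists (i, j); split; first by rewrite /= neq_ltn lt_ij.
  by rewrite flatE; apply/seteqP; split=> x; rewrite /diff_hyperplane /= => eq_x; lra.
- have {}lt_ij : (i < j)%N := lt_ij.
  exists (j, i); split; first by rewrite /= neq_ltn lt_ij orbT.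
  by rewrite flatE; apply/seteqP; split=> x; rewrite /diff_hyperplane /= => eq_x; lra.
have [lt_ij|lt_ji|/val_inj eq_ij] := ltngtP i j; last by rewrite eq_ij eqxx in ne_ij.
  apply/orP; left; apply/imfsetP; exists (i, j) => //=.
  by rewrite flatE; apply/seteqP; split=> x; rewrite /diff_hyperplane /= => eq_x; lra.
apply/orP; right; by apply/imfsetP; exists (j, i) => //=; rewrite flatE.
Qed.

Lemma mem_semiorder_poset X : X \in P <-> X !=set0 /\ exists B, X = diff_flat B.
Proof.
rewrite !inE /=; split=> [/andP[/imfsetP[C /= CA ->] ne0]|[ne0 [B XB]]].
  split; first by apply/set0P.
  rewrite fpowersetE in CA; have {}CA := fsubsetP CA.
  exists [set ij | (ij.1 != ij.2) && (diff_flat [set ij]%SET \in C)]%SET.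
  apply/seteqP; split=> x /=.
    by move=> xC i j; rewrite inE => /andP[_ /xC]; apply; rewrite inE.
  move=> xB H /= HC; have /mem_semiorder_hyperplanes[[i j] [ne_ij eqH]] := CA H HC.
  move=> /=; rewrite eqH => k l; rewrite inE => /eqP[-> ->]; apply: xB.
  by rewrite inE ne_ij -eqH.
apply/andP; split; last by apply/set0P.
apply/imfsetP; exists [fset diff_flat [set ij]%SET | ij in B]%fset => /=.
  rewrite fpowersetE; apply/fsubsetP => H /imfsetP[[i j] /= ijB ->].
  apply/mem_semiorder_hyperplanes; exists (i, j); split=> //=.
  apply/eqP => eq_ij; have [x] := ne0; rewrite XB => /(_ i j ijB).
  by rewrite eq_ij subrr => /esym/eqP; rewrite oner_eq0.
rewrite XB; apply/seteqP; split=> x /=.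
  move=> xB H /= /imfsetP[[i j] /= ijB ->] k l.
  by rewrite inE => /eqP[-> ->]; apply: xB.
move=> xC i j ijB; apply: (xC (diff_flat [set (i, j)]%SET)); last by rewrite inE.
by apply/imfsetP; exists (i, j).
Qed.

Lemma sum_semiorder_poset (W : nmodType) (Q : pred (set V))
    (G : set V -> {set 'I_n * 'I_n} -> W) :
  \sum_(X <- P | Q X) \sum_(B | diff_flat B == X) G X B
    = \sum_(B | (diff_flat B \in P) && Q (diff_flat B)) G (diff_flat B) B.
Proof.
rewrite (exchange_big_dep xpredT) //= [RHS]big_mkcond; apply: eq_bigr => B _.
have [BP|BP] /= := boolP (diff_flat B \in P); last first.
  rewrite big_seq_cond big1 // => X /and3P[XP _ /eqP eqX].
  by rewrite eqX XP in BP.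
case: ifP => QB; last first.
  by rewrite big1 // => X /andP[QX /eqP eqX]; rewrite -eqX QB in QX.
rewrite (eq_bigl (pred1 (diff_flat B))) => [|X]; last first.
  by rewrite /= eq_sym; case: eqP => [->|]; rewrite ?QB ?andbF.
by rewrite -big_filter filter_pred1_uniq ?fset_uniq // big_seq1.
Qed.

Lemma flat_leP X Y : flat_le X Y <-> Y `<=` X.
Proof. by split=> /asboolP. Qed.

(** Summing the right-hand side over the flats containing [Y] gives the alternating sum over all
    subsets of the set [S] of equations valid on [Y]. It vanishes unless [S] is empty, that is,
    unless [Y] is the whole space; so [moebius_unique] applies. *)
Lemma moebius_semiorder X : X \in P ->
  moebius P (@flat_le R n) setT X = \sum_(B | diff_flat B == X) (-1) ^+ #|B|.
Proof.
have sum_sub Y : Y \in P -> \sum_(X <- P | flat_le X Y)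
    \sum_(B | diff_flat B == X) (-1) ^+ #|B| = (Y == setT)%:R :> int.
  move=> /mem_semiorder_poset[[y Yy] [B YB]].
  rewrite (sum_semiorder_poset (@flat_le R n ^~ Y) (fun _ B => (-1) ^+ #|B|)).
  pose S := [set ij | `[< Y `<=` diff_flat [set ij]%SET >]]%SET.
  rewrite (eq_bigl (fun B : {set _} => B \subset S)) => [|C]; last first.
    apply/andP/idP => [[_ /flat_leP /sub_diff_flat //]|/sub_diff_flat YC].
    split; last exact/flat_leP.
    by apply/mem_semiorder_poset; split; [exists y; apply: YC|exists C].
  rewrite sum_subset_sign; congr (_%:R); congr nat_of_bool.
  apply/eqP/eqP => [S0|YT].
    have : Y `<=` diff_flat B by rewrite YB.
    by move/sub_diff_flat; rewrite -/S S0 finset.subset0 YB => /eqP ->; rewrite diff_flat0.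
  apply/finset.setP => -[i j]; rewrite !inE; apply/asboolP.
  rewrite YT => /(_ 0 I i j); rewrite inE eqxx !mxE subrr => /(_ isT) /esym/eqP.
  by rewrite oner_eq0.
have TP : setT \in P.
  by apply/mem_semiorder_poset; split; [exists 0|exists finset.set0; rewrite diff_flat0].
apply: (@moebius_unique _ P (@flat_le R n) _ _ _
  (fun X => \sum_(B | diff_flat B == X) (-1) ^+ #|B|)).
- by move=> Y; apply/flat_leP.
- by move=> Y1 Y2 Y3 /flat_leP h1 /flat_leP h2; apply/flat_leP; apply: subset_trans h1.
- by move=> Y1 Y2 /flat_leP h1 /flat_leP h2; apply/seteqP.
- by move=> Y; apply/flat_leP.
- have := sum_sub _ TP; rewrite eqxx => sumT.
  transitivity (true%:R : int) => //; rewrite -sumT (eq_bigl (pred1 setT)) => [|Y].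
    by rewrite -big_filter filter_pred1_uniq ?fset_uniq // big_seq1.
  by apply/idP/eqP => [/flat_leP YT|->]; [apply/seteqP|apply/flat_leP].
- by move=> Y YP neT; rewrite sum_sub // (negPf neT).
Qed.

Lemma charpoly_semiorder :
  charpoly (semiorder_arrangement R n)
    = \sum_(B : {set 'I_n * 'I_n} | `[< diff_flat B !=set0 >])
        (-1) ^+ #|B| *: 'X^(nblocks B).
Proof.
rewrite /charpoly big_seq.
transitivity (\sum_(X <- P | X \in P) \sum_(B | diff_flat B == X)
    ((-1) ^+ #|B| *: 'X^(n - flat_rank X) : {poly int})).
  by apply: eq_bigr => X XP; rewrite moebius_semiorder // scaler_suml.
rewrite (sum_semiorder_poset (mem P)
  (fun X B => (-1) ^+ #|B| *: 'X^(n - flat_rank X) : {poly int})).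
apply: eq_big => [B|B /andP[_ /mem_semiorder_poset[ne0 _]]].
  rewrite [X in _ && X]/= andbb; apply/idP/asboolP => [/mem_semiorder_poset[]//|ne0].
  by apply/mem_semiorder_poset; split=> //; exists B.
by rewrite /flat_rank affine_dim_diff_flat // subKn // nblocks_le.
Qed.

(** * Counting solutions modulo q *)

Section FiniteField.
Variable m : nat.
Hypothesis lt_nm : (n < m.+2)%N.
Local Notation q := m.+2.

Definition mod_flat B : {set {ffun 'I_n -> 'Z_q}} :=
  [set f : {ffun 'I_n -> 'Z_q} |
    [forall i, forall j, ((i, j) \in B) ==> (f j - f i == 1)]]%SET.

Lemma mod_flatP B (f : {ffun 'I_n -> 'Z_q}) :
  reflect (forall i j, (i, j) \in B -> f j - f i = 1) (f \in mod_flat B).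
Proof.
rewrite inE; apply: (iffP forallP) => [fB i j ijB|fB i].
  by have /forallP/(_ j) := fB i; rewrite ijB => /eqP.
by apply/forallP => j; apply/implyP => /fB ->.
Qed.

(** The floors of a real solution, reduced modulo q, solve the system over Z/q because floor
    commutes with adding 1. Subtracting this solution leaves the functions constant on the blocks of
    [B]. *)
Lemma card_mod_flat B : diff_flat B !=set0 ->
  #|mod_flat B| = (q ^ nblocks B)%N.
Proof.
move=> [p pB]; pose z i : 'Z_q := (Num.floor (p 0 i))%:~R.
have zB i j : (i, j) \in B -> z j = z i + 1.
  move=> ijB; have -> : z j = (Num.floor (p 0 i + 1))%:~R.
    by rewrite /z; congr (_%:~R); congr Num.floor; have := pB i j ijB; lra.
  by rewrite floorDrz ?rpred1 // floor1 intrD.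
pose tr (f : {ffun 'I_n -> 'Z_q}) := [ffun i => f i - z i].
have tr_inj : injective tr.
  by move=> f g /ffunP eq_fg; apply/ffunP => i; have := eq_fg i; rewrite !ffunE => /addIr.
rewrite -(card_imset _ tr_inj) -[q in RHS](card_ord q).
rewrite -(card_ffun_retract (root_root (@pair_rel_sym n B))).
apply: eq_card => g; rewrite inE; apply/imsetP/idP => [[f /mod_flatP fB ->]|].
  apply/constant_on_blocks => i j ijB; rewrite !ffunE (zB i j ijB).
  by rewrite opprD addrA [RHS]addrAC; congr (_ - _); rewrite -(fB i j ijB) subKr.
move/constant_on_blocks => gB; exists [ffun i => g i + z i]; last first.
  by apply/ffunP => i; rewrite !ffunE addrK.
apply/mod_flatP => i j ijB; rewrite !ffunE (gB i j ijB) (zB i j ijB).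
by ring.
Qed.

(* A residue missed by f cuts the cycle Z/q open, and the resulting integer
   representatives of f satisfy the same difference equations over R. *)
Lemma mod_flat_lift B f : f \in mod_flat B -> diff_flat B !=set0.
Proof.
move=> /mod_flatP fB.
have [c cf] : exists c : 'Z_q, forall i, f i != c.
  have : (#|ffun_image f| < #|'Z_q|)%N.
    by rewrite card_ord (leq_ltn_trans (leq_imset_card _ _)) // card_ord.
  rewrite -cardsT; case: (finset.set_0Vmem (~: ffun_image f)) => [C0|[c cC] _].
    by rewrite -(finset.setCK (ffun_image f)) C0 finset.setC0 ltnn.
  exists c => i; move: cC; rewrite inE; apply: contra => /eqP <-.
  exact: imset_f.
exists (\row_i (nat_of_ord (f i - c))%:R) => i j ijB; rewrite !mxE.
have eq_j : f j - c = (f i - c) + 1 by rewrite -(fB i j ijB); ring.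
set d : 'Z_q := f i - c in eq_j *.
have : f j - c != 0 by rewrite subr_eq0 cf.
rewrite eq_j -val_eqE /= (@modn_small 1) // => ne0.
have lt_q : (d < q)%N := ltn_ord _.
have lt_q1 : (d + 1 < q)%N.
  rewrite addn1 ltn_neqAle -addn1; apply/andP; split; last by rewrite addn1.
  by apply: contra ne0 => /eqP ->; rewrite modnn.
by rewrite modn_small // natrD addrC addKr.
Qed.

(** In Whitney's expansion each power of q counts solutions modulo q, and systems without real
    solution have none by [mod_flat_lift]. After exchanging the sums, a map [f] contributes the
    alternating sum over the subsets of [S f], hence 1 or 0 according to whether [S f] is empty. *)
Lemma charpoly_semiorder_mod :
  (charpoly (semiorder_arrangement R n)).[q%:Z]
    = #|[set f : {ffun 'I_n -> 'Z_q} | [forall i, forall j, f j - f i != 1]]%SET|%:Z.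
Proof.
pose S (f : {ffun 'I_n -> 'Z_q}) := [set ij : 'I_n * 'I_n | f ij.2 - f ij.1 == 1]%SET.
have inS f B : (B \subset S f) = (f \in mod_flat B).
  apply/fintype.subsetP/mod_flatP => [BS i j /BS|fB [i j] /fB].
    by rewrite inE => /eqP.
  by rewrite inE => /eqP.
transitivity (\sum_(f : {ffun 'I_n -> 'Z_q}) \sum_(B : {set _} | B \subset S f) (-1) ^+ #|B| : int).
  rewrite (exchange_big_dep xpredT) //= charpoly_semiorder horner_sum big_mkcond.
  apply: eq_bigr => B _; rewrite sumr_const.
  have -> : #|[pred f | B \subset S f]| = #|mod_flat B|.
    by apply: eq_card => f; rewrite inE inS.
  case: asboolP => [ne0|eq0].
    by rewrite card_mod_flat // hornerZ hornerXn -[RHS]mulr_natr natrX natz.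
  rewrite eq_card0 ?mulr0n // => f; apply/negP => /mod_flat_lift.
  exact: eq0.
rewrite (eq_bigr (fun f => (S f == finset.set0)%:R)) => [|f _]; last first.
  exact: sum_subset_sign.
rewrite -natr_sum -[RHS]natz; congr (_%:R); rewrite -sum1_card big_mkcond.
rewrite [RHS]big_mkcond; apply: eq_bigr => f _; rewrite inE.
suff -> : (S f == finset.set0) = [forall i, forall j, f j - f i != 1] by case: ifP.
apply/eqP/forallP => [S0 i|fn].
  by apply/forallP => j; have := finset.in_set0 (i, j); rewrite -S0 inE => ->.
apply/finset.setP => -[i j]; rewrite !inE; apply/negbTE.
by have /forallP := fn i; apply.
Qed.

End FiniteField.

End DiffFlats.

(** * Regions and semiorders *)

Section Perturbation.
Variable R : realFieldType.

Lemma small_perturbation (a b : R) : 0 < a ->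
  exists2 eps, 0 < eps & forall d, `|d| <= eps -> 0 < a + d * b.
Proof.
move=> a0; have b0 : 0 <= `|b| by [].
(* With this bound |d b| is at most a/2, and adding 1 to |b| keeps the denominator positive. *)
exists (a / (2 * (1 + `|b|))) => [|d]; first by apply: divr_gt0 => //; lra.
rewrite ler_pdivlMr; last by lra.
have := ler_norm (- (d * b)); rewrite normrN normrM => le_db le_d.
have d0 : 0 <= `|d| by []; nra.
Qed.

Lemma finite_perturbation (T : finType) (D : {set T}) (Q : T -> R -> Prop) :
  (forall k, k \in D -> exists2 eps, 0 < eps & forall d, `|d| <= eps -> Q k d) ->
  exists2 eps, 0 < eps & forall d, `|d| <= eps -> forall k, k \in D -> Q k d.
Proof.
elim/subset_ind: D => [_|k D kD IHD QD]; first by exists 1 => // d _ k; rewrite inE.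
have [|e1 e10 Q1] := IHD; first by move=> i iD; apply: QD; rewrite !inE iD orbT.
have [|e2 e20 Q2] := QD k; first by rewrite !inE eqxx.
exists (Num.min e1 e2); first by rewrite lt_min e10.
move=> d; rewrite le_min => /andP[d1 d2] i; rewrite !inE => /orP[/eqP->|iD].
  exact: Q2.
exact: Q1.
Qed.

End Perturbation.

(** * Cells of an affine arrangement and Zaslavsky's theorem *)

Section Regions.
Local Open Scope classical_set_scope.
Variables (R : realType) (n : nat) (T : finType).
Local Notation V := 'rV[R]_n.
Variables (l : T -> {linear V -> R^o}) (c : T -> R).
Implicit Types (X : set V) (B S D : {set T}) (k : T).

Definition hyperplanes_meet B : set V := [set x | forall k, k \in B -> l k x = c k].

Definition open_cell D S : set V :=
  [set x | forall k, k \in D -> if k \in S then c k < l k x else l k x < c k].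

(** The empty set is included so that the class is stable under intersection with a hyperplane. *)
Definition is_affine X := X = set0 \/ exists p U, X = affine_space p U.

Local Notation nonempty X := `[< (X : set V) !=set0 >].

Let nonempty0 : nonempty set0 = false.
Proof. by apply/asboolP => -[]. Qed.

Variant affine_cut_spec X k : Prop :=
| CutFull of (forall x, X x -> l k x = c k)
| CutBelow of (forall x, X x -> l k x < c k)
| CutAbove of (forall x, X x -> c k < l k x)
| CutProper of is_affine (X `&` hyperplanes_meet [set k]%SET)
    & affine_dim X = (affine_dim (X `&` hyperplanes_meet [set k]%SET)).+1
    & exists2 u, l k u != 0 & forall x d, X x -> X (x + d *: u).

(** The cut is proper exactly when [l k] does not vanish on the direction space; otherwise [l k] is
    constant on the affine space. *)
Lemma affine_cutP p (U : {vspace V}) k : affine_cut_spec (affine_space p U) k.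
Proof.
have [[u uU lu]|l0] := pselect (exists2 u, u \in U & l k u != 0); last first.
  have lE x : affine_space p U x -> l k x = l k p.
    rewrite /affine_space /= => xU; apply/eqP; rewrite -subr_eq0 -linearB.
    by apply/negPn/negP => ne0; apply: l0; exists (x - p).
  have [lt_pc|lt_cp|eq_pc] := ltgtP (l k p) (c k).
  - by apply: CutBelow => x /lE ->.
  - by apply: CutAbove => x /lE ->.
  - by apply: CutFull => x /lE ->.
(* [p'] is [p] moved along [u] onto the hyperplane. *)
pose p' := p + ((c k - l k p) / l k u) *: u.
pose U' := (U :&: lker (linfun (l k)))%VS.
have lp' : l k p' = c k by rewrite linearD linearZ /= /GRing.scale /= divfK // subrKC.
have cutE : affine_space p U `&` hyperplanes_meet [set k]%SET = affine_space p' U'.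
  apply/seteqP; split=> x; rewrite /affine_space /hyperplanes_meet /=.
    move=> [xU /(_ k)]; rewrite inE => /(_ (eqxx _)) lx.
    rewrite memv_cap memv_ker lfunE /= linearB lp' lx subrr eqxx andbT.
    by rewrite /p' opprD addrA rpredB // rpredZ.
  rewrite memv_cap memv_ker lfunE /= linearB lp' subr_eq0 => /andP[xU /eqP lx].
  split; last by move=> i; rewrite inE => /eqP ->.
  have -> : x - p = x - p' + ((c k - l k p) / l k u) *: u.
    by rewrite /p' opprD addrA subrK.
  by rewrite rpredD // rpredZ.
apply: CutProper.
- by right; exists p', U'.
(* Rank-nullity: the image of [U] under [l k] is nonzero in a line, so the kernel has codimension
   one. *)
- rewrite cutE !affine_dimE -(limg_ker_dim (linfun (l k)) U) -/U' -[RHS]addn1.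
  congr (_ + _)%N; apply/eqP; rewrite eqn_leq; apply/andP; split.
    by apply: leq_trans (dimvS (subvf _)) _; rewrite dimvf.
  rewrite lt0n dimv_eq0; apply: contra lu => /eqP img0.
  have := memv_img (linfun (l k)) uU; rewrite img0 memv0 lfunE /=.
  by [].
- exists u => // x d; rewrite /affine_space /= => xU.
  by rewrite addrAC rpredD // rpredZ.
Qed.

Lemma hyperplanes_meetU1 k B :
  hyperplanes_meet (k |: B)%SET
    = hyperplanes_meet [set k]%SET `&` hyperplanes_meet B.
Proof.
apply/seteqP; split=> x /= => [xkB|[xk xB] i].
  split=> i iB; apply: xkB; rewrite inE; last by rewrite iB orbT.
  by rewrite iB.
by rewrite !inE => /orP[ik|iB]; [apply: xk; rewrite inE|apply: xB].
Qed.

Lemma open_cellU1 k D S : k \notin D -> S \subset D ->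
  open_cell (k |: D)%SET S = open_cell D S `&` [set x | l k x < c k].
Proof.
move=> kD SD; have kS : k \notin S by apply: contra kD => /(fintype.subsetP SD).
apply/seteqP; split=> x /= => [xC|[xC xk] i].
  split=> [i iD|]; first by apply: xC; rewrite !inE iD orbT.
  by have := xC k; rewrite !inE eqxx (negPf kS); apply.
by rewrite !inE => /orP[/eqP->|/xC//]; rewrite (negPf kS).
Qed.

Lemma open_cellU1U1 k D S : k \notin D -> S \subset D ->
  open_cell (k |: D)%SET (k |: S)%SET = open_cell D S `&` [set x | c k < l k x].
Proof.
move=> kD SD; apply/seteqP; split=> x /= => [xC|[xC xk] i].
  split=> [i iD|]; last by have := xC k; rewrite !inE eqxx; apply.
  have ne_ik : (i == k) = false by apply: contraNF kD => /eqP <-.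
  by have := xC i; rewrite !inE iD ne_ik orbT; apply.
rewrite !inE => /orP[/eqP->|iD]; first by rewrite eqxx.
have ne_ik : (i == k) = false by apply: contraNF kD => /eqP <-.
by rewrite ne_ik; apply: xC.
Qed.

Lemma open_cell_perturb D S x u : open_cell D S x ->
  exists2 eps, 0 < eps & forall d, `|d| <= eps -> open_cell D S (x + d *: u).
Proof.
move=> xC; apply: finite_perturbation => k /xC; case: ifP => _ ltx.
  have [|eps eps0 e_pos] := @small_perturbation _ (l k x - c k) (l k u).
    by rewrite subr_gt0.
  exists eps => // d /e_pos; rewrite linearD linearZ /= /GRing.scale /=.
  by rewrite -subr_gt0; lra.
have [|eps eps0 e_pos] := @small_perturbation _ (c k - l k x) (- l k u).
  by rewrite subr_gt0.
exists eps => // d /e_pos; rewrite linearD linearZ /= /GRing.scale /=.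
by rewrite mulrN -subr_gt0; lra.
Qed.

Lemma open_cell_segment D S x y t : 0 <= t <= 1 ->
  open_cell D S x -> open_cell D S y -> open_cell D S (x + t *: (y - x)).
Proof.
move=> /andP[t0 t1] xC yC k kD; have := xC k kD; have := yC k kD.
rewrite linearD linearZ linearB /= /GRing.scale /=.
by case: ifP => _ lt_y lt_x; case: (lerP (l k x) (l k y)) => le_xy; nra.
Qed.

(** If [X] lies in the hyperplane, both sides are 0; if it lies strictly on one side, only one piece
    survives. In a proper cut the dimension drops by one, and the claim becomes: below + above =
    cell + section. A point of the section can be pushed to both sides; without such a point,
    convexity keeps a nonempty cell on a single side. *)
Lemma regions_cut p U D S k (X := affine_space p U) :
  (-1) ^+ affine_dim X
      * ((nonempty (X `&` (open_cell D S `&` [set x | l k x < c k])))%:R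
        + (nonempty (X `&` (open_cell D S `&` [set x | c k < l k x])))%:R)
    = (-1) ^+ affine_dim X * (nonempty (X `&` open_cell D S))%:R
      - (-1) ^+ affine_dim (X `&` hyperplanes_meet [set k]%SET)
        * (nonempty (X `&` hyperplanes_meet [set k]%SET `&` open_cell D S))%:R :> int.
Proof.
have meetE x : hyperplanes_meet [set k]%SET x <-> l k x = c k.
  by split=> [|lx i]; [apply; rewrite inE|rewrite inE => /eqP ->].
have in_nonempty Y y : Y y -> nonempty Y by move=> Yy; apply/asboolP; exists y.
have nonemptyN Y : (forall y, ~ Y y) -> nonempty Y = false.
  by move=> Y0; apply/asboolP => -[y]; apply: Y0.
have [full|below|above|_ -> [u lu Xu]] := affine_cutP p U k; rewrite -/X.
- have -> : X `&` hyperplanes_meet [set k]%SET = X.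
    by apply/seteqP; split=> x [] // Xx; split=> //; apply/meetE/full.
  rewrite subrr !nonemptyN ?mulr0 // => x [] /full eqx [_] /=; rewrite eqx ltxx //.
- rewrite [nonempty (_ `&` _ `&` _)]nonemptyN; last first.
    by move=> x [[/below ltx /meetE eqx]]; rewrite eqx ltxx in ltx.
  rewrite mulr0 subr0 [nonempty (X `&` (_ `&` [set x | c k < _]))]nonemptyN; last first.
    by move=> x [/below ltx [_ /= gtx]]; have := lt_trans ltx gtx; rewrite ltxx.
  rewrite addr0; congr (_ * (nonempty _)%:R); apply/seteqP; split=> x [Xx].
    by case.
  by move=> xC; split=> //; split=> //; apply: below.
- rewrite [nonempty (_ `&` _ `&` _)]nonemptyN; last first.
    by move=> x [[/above ltx /meetE eqx]]; rewrite eqx ltxx in ltx.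
  rewrite mulr0 subr0 [nonempty (X `&` (_ `&` [set x | _ < c k]))]nonemptyN; last first.
    by move=> x [/above ltx [_ /= gtx]]; have := lt_trans ltx gtx; rewrite ltxx.
  rewrite add0r; congr (_ * (nonempty _)%:R); apply/seteqP; split=> x [Xx].
    by case.
  by move=> xC; split=> //; split=> //; apply: above.
rewrite exprS mulN1r !mulNr -opprD -mulrDr; congr (- (_ * _)).
have [/asboolP [z [[Xz /meetE lz] zC]]|/asboolP cut0] :=
    boolP (nonempty (X `&` hyperplanes_meet [set k]%SET `&` open_cell D S)).
  have [eps eps0 zeps] := open_cell_perturb u zC.
  (* The quotient of |l k u| by l k u is a sign: the sign of [s] thus decides the side, while the
     step keeps size [eps] when |s| = 1. *)
  pose dir (s : R) := z + (s * eps * `|l k u| / l k u) *: u.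
  have Cdir s : `|s| = 1 -> X (dir s) /\ open_cell D S (dir s).
    move=> s1; split; first exact: Xu.
    apply: zeps; rewrite !normrM s1 normfV normr_id mul1r mulfK ?normr_eq0 //.
    by rewrite gtr0_norm.
  have ldir s : l k (dir s) = c k + s * eps * `|l k u|.
    by rewrite /dir linearD linearZ /= /GRing.scale /= divfK // lz.
  have pos : 0 < eps * `|l k u| by rewrite mulr_gt0 // normr_gt0.
  have [X1 C1] := Cdir 1 (normr1 _); have [X2 C2] := Cdir (-1) (normrN1 _).
  rewrite (in_nonempty _ (dir (-1))); last by split=> //; split=> //=; rewrite ldir; nra.
  rewrite (in_nonempty _ (dir 1)); last by split=> //; split=> //=; rewrite ldir; nra.
  by rewrite (in_nonempty _ z).
rewrite addr0.
have [/asboolP [x [Xx xC]]|/asboolP C0] := boolP (nonempty (X `&` open_cell D S)); last first.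
  rewrite !nonemptyN // => x [Xx [xC _]]; apply: C0; exists x => //.
have no_both y z : X y -> X z -> open_cell D S y -> open_cell D S z ->
    l k y < c k -> c k < l k z -> False.
  move=> Xy Xz yC zC lt_y lt_z; apply: cut0.
  (* The parameter at which the segment from [y] to [z] crosses the hyperplane. *)
  pose t := (c k - l k y) / (l k z - l k y).
  have t01 : 0 <= t <= 1.
    by rewrite /t ler_pdivlMr ?ler_pdivrMr; lra.
  exists (y + t *: (z - y)); split; last exact: open_cell_segment.
  split.
    move: Xy Xz; rewrite /X /affine_space /= => yU zU.
    rewrite addrAC rpredD // rpredZ //.
    have -> : z - y = (z - p) - (y - p) by rewrite opprB addrA subrK.
    exact: rpredB.
  apply/meetE; rewrite linearD linearZ linearB /= /GRing.scale /= /t divfK ?subrKC //.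
  by rewrite subr_eq0; apply/eqP; lra.
have [lt_x|lt_x|eq_x] := ltgtP (l k x) (c k).
- rewrite (in_nonempty _ x); last by [].
  rewrite nonemptyN // => y [Xy [yC ly]].
  exact: (no_both x y).
- rewrite nonemptyN; last by move=> y [Xy [yC ly]]; exact: (no_both y x).
  by rewrite (in_nonempty _ x).
- by case: cut0; exists x; split=> //; split=> //; apply/meetE.
Qed.

(* Zaslavsky's theorem, by deletion and restriction: a proper cut of X by a
   hyperplane splits exactly the cells of X that it meets. *)
Lemma zaslavsky D X : is_affine X ->
  (-1) ^+ affine_dim X
      * \sum_(S : {set T} | S \subset D) (`[< X `&` open_cell D S !=set0 >])%:R
    = \sum_(B : {set T} | B \subset D)
        (`[< X `&` hyperplanes_meet B !=set0 >])%:R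
        * (-1) ^+ (#|B| + affine_dim (X `&` hyperplanes_meet B)) :> int.
Proof.
elim/subset_ind: D X => [|k D kD IHD] X affX.
  have subs0 (S : {set T}) : (S \subset finset.set0) = (S == finset.set0).
    by rewrite finset.subset0.
  rewrite !(eq_bigl _ _ subs0) !big_pred1_eq cards0 add0n.
  have -> : open_cell finset.set0 finset.set0 = setT.
    by apply/seteqP; split=> x //= _ k; rewrite inE.
  have -> : hyperplanes_meet finset.set0 = setT.
    by apply/seteqP; split=> x //= _ k; rewrite inE.
  by rewrite setIT mulrC.
have [X0|[p [U XE]]] := affX.
  rewrite X0 !big1 ?mulr0 // => S _; rewrite set0I nonempty0 //.
  by rewrite mul0r.
have affX' : is_affine (X `&` hyperplanes_meet [set k]%SET).
  have := affine_cutP p U k; rewrite -XE => -[full|below|above|aff _ _].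
  - right; exists p, U; rewrite -XE; apply/seteqP; split=> x => [[]//|Xx]; split=> //.
    by move=> i; rewrite inE => /eqP ->; apply: full.
  - left; apply/seteqP; split=> x [] // Xx xk; have := below x Xx.
    by rewrite xk ?inE // ltxx.
  - left; apply/seteqP; split=> x [] // Xx xk; have := above x Xx.
    by rewrite xk ?inE // ltxx.
  - exact: aff.
rewrite !sum_subsetU1 // -big_split mulr_sumr /=.
transitivity (\sum_(S : {set T} | S \subset D)
   ((-1) ^+ affine_dim X * (nonempty (X `&` open_cell D S))%:R
      - (-1) ^+ affine_dim (X `&` hyperplanes_meet [set k]%SET)
        * (nonempty (X `&` hyperplanes_meet [set k]%SET `&` open_cell D S))%:R) : int).
  apply: eq_bigr => S SD; rewrite open_cellU1 // open_cellU1U1 //.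
  by rewrite XE; exact: regions_cut.
rewrite sumrB -!mulr_sumr !IHD //; congr (_ + _).
rewrite -sumrN; apply: eq_bigr => B BD; rewrite hyperplanes_meetU1 setIA.
have kB : k \notin B by apply: contra kD => /(fintype.subsetP BD).
by rewrite cardsU1 kB addSn exprS mulN1r mulrN.
Qed.

End Regions.

(** * Semiorders as regions of the arrangement *)

Section Semiorders.
Local Open Scope classical_set_scope.
Variables (R : realType) (n : nat).
Local Notation V := 'rV[R]_n.
Local Notation pairs := ('I_n * 'I_n)%type.

Definition diff_form (ij : pairs) (x : V) : R^o := x 0 ij.2 - x 0 ij.1.

Lemma diff_form_linear ij : linear (diff_form ij).
Proof.
move=> a x y; rewrite /diff_form !mxE /GRing.scale /=; ring.
Qed.

HB.instance Definition _ ij := GRing.isLinear.Build R V R^o *:%R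
  (diff_form ij) (diff_form_linear ij).

Let l (ij : pairs) : {linear V -> R^o} := diff_form ij.

Lemma left_disjoint_itv (a b : R) :
  left_disjoint `[a, a + 1] `[b, b + 1] <-> a + 1 < b.
Proof.
split=> [[_]|lt_ab].
  by apply; rewrite /= in_itv /=; apply/andP; split=> //; lra.
split; last by move=> s t; rewrite /= !in_itv /= => /andP[_ ?] /andP[? _]; lra.
apply/seteqP; split=> x //=; rewrite !in_itv /= => -[/andP[_ ?] /andP[? _]]; lra.
Qed.

Lemma is_semiorderE (Q : {set pairs}) :
  is_semiorder R Q <->
  exists a : 'I_n -> R, forall i j, ((i, j) \in Q) = (i == j) || (a i + 1 < a j).
Proof.
split=> [[[Qrefl Qanti Qtrans] [I [Iitv IQ]]]|[a aQ]].
  have [a aI] := choice Iitv; exists a => i j.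
  have := IQ i j; rewrite !aI => IQij; case: eqVneq => [->|ne_ij]; first exact: Qrefl.
  apply/idP/idP => [ijQ|lt_ij].
    by apply/left_disjoint_itv/IQij.
  by have [] := IQij.2 ((left_disjoint_itv _ _).2 lt_ij).
split; last first.
  exists (fun i => `[a i, a i + 1]); split=> [i|i j]; first by exists (a i).
  split=> [[]|].
    by rewrite aQ => /orP[->//|lt_ij] _; apply/left_disjoint_itv.
  move/left_disjoint_itv => lt_ij; rewrite aQ lt_ij orbT; split=> //.
  by apply/eqP => eq_ij; move: lt_ij; rewrite eq_ij; lra.
split=> [i|i j|i j k]; first by rewrite aQ eqxx.
  rewrite !aQ => /orP[/eqP//|lt_ij] /orP[/eqP//|lt_ji].
  by exfalso; lra.
rewrite !aQ => /orP[/eqP->//|lt_ij] /orP[/eqP<-|lt_jk]; first by rewrite lt_ij orbT.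
by apply/orP; right; lra.
Qed.

(** A region is recorded by the pairs with x_j - x_i > 1. Diagonal pairs give 0 < 1, so they never
    belong to such a set and cut nothing off. *)
Let cells : {set {set pairs}} :=
  [set S | `[< open_cell l (fun=> 1) finset.setT S !=set0 >]]%SET.

Let diag : {set pairs} := [set ij | ij.1 == ij.2]%SET.

Let open_cellE S x : open_cell l (fun=> 1) finset.setT S x <->
  forall ij, (ij \in S) = (1 < l ij x) /\ l ij x != 1.
Proof.
split=> [xC ij|xS ij _].
  by have := xC ij; rewrite finset.in_setT => /(_ isT); case: ifP => _; case: ltgtP.
by have [-> ne1] := xS ij; move: ne1; case: ltgtP.
Qed.

(** A region gives a semiorder by adding the diagonal. Conversely, left endpoints of intervals may
    differ by exactly 1 and lie on a hyperplane; shrinking them by a factor slightly below 1 moves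
    them into a region with the same strict relations. *)
Lemma card_semiorders : nb_semiorders R n = #|cells|.
Proof.
have diag_inj : {in cells &, injective (fun S => S :|: diag)%SET}.
  have cellD S : S \in cells -> (S :|: diag)%SET :\: diag = S.
    rewrite inE => /asboolP[x /open_cellE xS]; apply/finset.setP => ij; rewrite !inE.
    case: eqP => [eq_ij|_] /=; last by rewrite orbF.
    have [-> _] := xS ij; rewrite /l /= /diff_form eq_ij subrr.
    by apply/esym/negbTE; rewrite -leNgt.
  by move=> S1 S2 S1c S2c eqS; rewrite -(cellD _ S1c) -(cellD _ S2c) eqS.
rewrite /nb_semiorders -(card_in_imset diag_inj); apply: eq_card => Q; rewrite inE.
apply/asboolP/imsetP => [/is_semiorderE[a aQ]|[S]]; last first.
  rewrite inE => /asboolP[x /open_cellE xS] ->; apply/is_semiorderE.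
  exists (fun i => x 0 i) => i j; rewrite !inE orbC /=; congr (_ || _).
  have [-> _] := xS (i, j); rewrite /l /= /diff_form /=.
  by apply/idP/idP; lra.
have [|eps eps0 eps_gt] := @finite_perturbation R _ finset.setT
    (fun (ij : pairs) d => 1 < a ij.2 - a ij.1 -> 1 < (1 - d) * (a ij.2 - a ij.1)).
  move=> ij _; have [gt1|le1] := ltP 1 (a ij.2 - a ij.1); last first.
    by exists 1.
  have [|eps eps0 e_pos] := @small_perturbation R (a ij.2 - a ij.1 - 1)
      (- (a ij.2 - a ij.1)); first by lra.
  by exists eps => // d /e_pos; lra.
(* [eps] preserves the differences above 1; the bound 1/2 keeps [1 - d] positive, so that
   differences at most 1 become smaller than 1. *)
pose d := Num.min eps 2^-1.
have d0 : 0 < d by rewrite lt_min eps0 /=; lra.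
have [d1 d2] : d <= eps /\ d <= 2^-1 by apply/andP; rewrite -le_min.
have dP ij : 1 < a ij.2 - a ij.1 -> 1 < (1 - d) * (a ij.2 - a ij.1).
  by apply: eps_gt; rewrite ?finset.in_setT // ger0_norm // ltW.
have dN ij : a ij.2 - a ij.1 <= 1 -> (1 - d) * (a ij.2 - a ij.1) < 1.
  by move=> le1; nra.
pose x : V := \row_i ((1 - d) * a i).
have lx ij : l ij x = (1 - d) * (a ij.2 - a ij.1).
  by rewrite /l /= /diff_form !mxE mulrBr.
exists [set ij : pairs | 1 < a ij.2 - a ij.1]%SET.
  rewrite inE; apply/asboolP; exists x; apply/open_cellE => ij; rewrite lx inE.
  have [gt1|le1] := ltP 1 (a ij.2 - a ij.1).
    by have gt1' := dP _ gt1; rewrite gt1' gt_eqF.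
  by have lt1 := dN _ le1; rewrite lt_eqF //; split=> //; apply/esym/negbTE; rewrite -leNgt ltW.
apply/finset.setP => -[i j]; rewrite aQ !inE orbC /=; congr (_ || _).
by apply/idP/idP; lra.
Qed.

Lemma card_semiorders_charpoly :
  (nb_semiorders R n)%:Z = (-1) ^+ n * (charpoly (semiorder_arrangement R n)).[-1].
Proof.
have affT : is_affine [set: V].
  right; exists 0, fullv; apply/seteqP; split=> x //= _.
  by rewrite /affine_space /= memvf.
have dimT : affine_dim [set: V] = n.
  have -> : [set: V] = affine_space 0 fullv.
    by apply/seteqP; split=> x //= _; rewrite /affine_space /= memvf.
  by rewrite affine_dimE dimvf dim_matrix; apply: mul1n.
have meetE B : hyperplanes_meet l (fun=> 1) B = diff_flat B.
  by apply/seteqP; split=> x /= xB => [i j /xB|[i j] /xB].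
(* With [X] the whole space, the right-hand side is Whitney's expansion at -1. *)
have := zaslavsky l (fun=> 1) finset.setT affT.
rewrite dimT; under eq_bigl do rewrite finset.subsetT.
under [in X in _ = X -> _]eq_bigl do rewrite finset.subsetT.
have -> : \sum_(S : {set pairs})
    (`[< setT `&` open_cell l (fun=> 1) finset.setT S !=set0 >])%:R = #|cells|%:R :> int.
  rewrite -natr_sum -sum1_card [in RHS]big_mkcond; congr (_%:R).
  by apply: eq_bigr => S _; rewrite inE setTI; case: asboolP.
rewrite charpoly_semiorder horner_sum -card_semiorders natz => eq_nb.
rewrite -[LHS](signrMK n) eq_nb; congr (_ * _); rewrite [RHS]big_mkcond.
apply: eq_bigr => B _; rewrite setTI meetE; case: asboolP => [ne0|_]; last by rewrite mul0r.
by rewrite mul1r exprD hornerZ hornerXn affine_dim_diff_flat.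
Qed.

End Semiorders.

(** * Generating functions *)

Lemma poly_natr_roots_eq (p r : {poly rat}) N :
  (forall m, (N <= m)%N -> p.[m%:R] = r.[m%:R]) -> p = r.
Proof.
move=> eq_pr; apply/eqP; rewrite -subr_eq0; apply/negPn/negP => nz.
pose s := [seq m%:R : rat | m <- iota N (size (p - r))].
have s_uniq : uniq s by rewrite map_inj_uniq ?iota_uniq // => i j /eqP; rewrite eqr_nat => /eqP.
have s_roots : all (root (p - r)) s.
  apply/allP => x /mapP[m]; rewrite mem_iota => /andP[le_Nm _] ->.
  by rewrite rootE hornerD hornerN eq_pr // subrr.
by have := max_poly_roots nz s_roots s_uniq; rewrite size_map size_iota ltnn.
Qed.

Lemma coefs_generating_function (A : nat -> {fps rat})
    (y : {fps {fps rat}} := fpsX) (ex : {fps {fps rat}} := fpsC (fps_exp fpsX)) :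
  (1 - y + y * ex) / (1 - y + y ^+ 2 - y ^+ 2 * ex) = Fps A ->
  [/\ A 0%N = 1, A 1%N = 1 + (fps_exp fpsX - 1)
    & forall r, A r.+2 = A r.+1 + (fps_exp fpsX - 1) * A r].
Proof.
set den := (1 - y + y ^+ 2 - y ^+ 2 * ex) => hA.
(* Nesting the factors [y] lets [coefsXM] read off coefficients as shifts; clearing the denominator
   then gives the recurrence. *)
have denE : den = 1 - (y + y * (y * (ex - 1))) by rewrite /den; ring.
have den_unit : den \is a GRing.unit.
  by rewrite fps_unitE denE coefsB coefs1 coefsD !coefsXM addr0 subr0 unitr1.
have eqA : Fps A = 1 - y + y * ex + y * (Fps A + y * ((ex - 1) * Fps A)).
  have := congr1 (fun f => f * den) hA; rewrite divrK // => ->.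
  by rewrite denE; ring.
have exE : ex - 1 = fpsC (fps_exp fpsX - 1).
  by apply: fpsP => n; rewrite coefsB coefs1; case: n => [|n] //=; rewrite subr0.
have A_eq r := congr1 (fun f => coefs f r) eqA.
have A0 : A 0%N = 1.
  have := A_eq 0%N; rewrite [LHS]/= => ->.
  by rewrite !coefsD coefsN coefs1 !coefsXM subr0 !addr0.
have oneS r : coefs (1 : {fps {fps rat}}) r.+1 = 0 by rewrite coefs1.
have yE r : coefs y r = (r == 1)%N%:R by [].
split=> //.
  have := A_eq 1%N; rewrite [LHS]/= => ->.
  rewrite !(coefsD, coefsXM) coefsN oneS yE [coefs (Fps A) 0]/= A0 [coefs ex 0]/= mulr1n; ring.
move=> r; have := A_eq r.+2; rewrite [LHS]/= => ->.
rewrite !(coefsD, coefsXM) coefsN oneS yE exE coefsCM [coefs (Fps A) r.+1]/=.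
by rewrite [coefs (Fps A) r]/= [coefs ex r.+1]/= mulr0n; ring.
Qed.

(** For fixed n both sides are polynomials in q. They agree at every integer q >= n+3, which ensures
    both n < q and a cycle of length at least 3. *)
Lemma charpoly_semiorder_powq (R : realType) (L : {fps rat}) n :
  L ^+ 2 = L + (fps_exp fpsX - 1) -> coefs L 0 = 1 ->
  map_poly intr (charpoly (semiorder_arrangement R n))
    = n`!%:R * coefs (fps_powq L) n :> {poly rat}.
Proof.
move=> L_root L0; apply: (@poly_natr_roots_eq _ _ n.+3) => q le_nq.
have [m def_q] : exists m, q = m.+3 by exists q.-1.-2; lia.
have lt_nm : (n < m.+3)%N by lia.
rewrite def_q -[_.+3%:R in LHS](rmorph_nat (intr : {rmorphism int -> rat})) horner_map /=.
rewrite natz charpoly_semiorder_mod // -pmulrn (card_ffun_cycle L_root L0 lt_nm).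
rewrite hornerM -polyC_natr hornerC; congr (_ * _).
by rewrite -fps_eval_powq_nat.
Qed.

Theorem theorem4p17 (R : realType) (A : nat -> {fps rat})
    (y : {fps {fps rat}} := fpsX)
    (ex : {fps {fps rat}} := fpsC (fps_exp fpsX))
    (hA : (1 - y + y * ex) / (1 - y + y ^+ 2 - y ^+ 2 * ex) = Fps A) :
  (exists2 L : {fps rat},
      fps_cvg (fun r => A r / A r.-1) L &
      egf (fun n => map_poly intr (charpoly (semiorder_arrangement R n)))
        = fps_powq L)
  /\
  fps_cvg (fun r => A r.-1 / A r)
    (egf (fun n => (-1) ^+ n * (nb_semiorders R n)%:R)).
Proof.
have [A0 A1 A_rec] := coefs_generating_function hA.
have E0 : coefs (fps_exp fpsX - 1 : {fps rat}) 0 = 0.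
  by rewrite coefsB coefs1 /= big_ord1 expr0 coefs1 mulr1 fact0 invr1 subrr.
pose L := ratio_limit A.
have L0 : coefs L 0 = 1 := ratio_limit_coefs0 E0 A0 A1 A_rec.
have L_root : L ^+ 2 = L + (fps_exp fpsX - 1) := ratio_limit_sqr E0 A0 A1 A_rec.
split.
  exists L; first exact: (ratio_cvg E0 A0 A1 A_rec).
  apply: fpsP => n /=; rewrite (charpoly_semiorder_powq R n L_root L0) mulrC mulKr //.
  by rewrite -(prednK (fact_gt0 n)) poly_natr_unit.
(* Put q = -1 in the first part: the power of [L] becomes its inverse, and the value of the
   characteristic polynomial is the signed number of semiorders. *)
have -> : egf (fun n => (-1) ^+ n * (nb_semiorders R n)%:R) = L^-1.
  apply: fpsP => n; rewrite -(fps_eval_powqN1 L0) /=.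
  have n0 : n`!%:R != 0 :> rat by rewrite pnatr_eq0 -lt0n fact_gt0.
  apply: (mulIf n0); rewrite divfK //.
  have := congr1 (fun p : {poly rat} => p.[-1]) (charpoly_semiorder_powq R n L_root L0).
  rewrite hornerM -polyC_natr hornerC [RHS]mulrC => <-.
  have -> : -1 = (-1)%:~R :> rat by [].
  rewrite horner_map /= -[(nb_semiorders R n)%:R]/((nb_semiorders R n)%:Z%:~R).
  by rewrite card_semiorders_charpoly rmorphM rmorphXn /= signrMK.
exact: (ratio_cvgV E0 A0 A1 A_rec).
Qed.
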